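(* Let $N\ge1$ and let $x_1,\ldots,x_N,y_1,\ldots,y_N\ge0$, $\beta_1,\ldots,\beta_{N-1}\le0$ be real with $x_iy_j<1$ for all $i,j$. Let $\lambda=(\lambda_1,\ldots,\lambda_N)$ be distributed according to the Grothendieck measure $\mathscr{M}_{\vec\beta;\mathrm{Gr}}$, and let $(\mu^1,\ldots,\mu^N)$ be distributed according to the Schur process $\mathscr{M}^{2d}_{\vec\beta;\mathrm{Gr}}$. Then the joint distributions of the integer $N$-tuples $(\lambda_1,\lambda_2,\ldots,\lambda_N)$ and $(\mu^1_1,\mu^2_2,\ldots,\mu^N_N)$ coincide.
   Context: Partitions have at most $N$ parts: $\lambda=(\lambda_1\ge\cdots\ge\lambda_N\ge0)$. Define polynomials (evaluated by continuity at coinciding or zero arguments) $$G_\lambda(x_1,\ldots,x_N)=\frac{\det\bigl[x_i^{\lambda_j+N-j}\prod_{r=1}^{j-1}(1-\beta_rx_i)\bigr]_{i,j=1}^N}{\prod_{i<j}(x_i-x_j)},\qquad \overline G_\lambda(y_1,\ldots,y_N)=\frac{\det\bigl[y_i^{\lambda_j+N-j}\prod_{r=j}^{N-1}(1-\beta_ry_i^{-1})\bigr]_{i,j=1}^N}{\prod_{i<j}(y_i-y_j)}.$$ The (multiparameter) Grothendieck measure is $$\mathscr{M}_{\vec\beta;\mathrm{Gr}}(\lambda)=\frac{\prod_{i,j=1}^N(1-x_iy_j)}{\prod_{i=1}^N\prod_{r=1}^{N-1}(1-x_i\beta_r)}\,G_\lambda(x_1,\ldots,x_N)\,\overline G_\lambda(y_1,\ldots,y_N).$$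 The Schur process $\mathscr{M}^{2d}_{\vec\beta;\mathrm{Gr}}$ is the probability measure on $N$-tuples of partitions $(\mu^1,\ldots,\mu^N)$, each with at most $N$ parts, with weights proportional to $$s_{\mu^1}(x_1,\ldots,x_N)\;s_{(\mu^1)'/(\mu^2)'}(-\beta_1)\cdots s_{(\mu^{N-1})'/(\mu^N)'}(-\beta_{N-1})\;s_{\mu^N}(y_1,\ldots,y_N),$$ where $s$ denotes (skew) Schur polynomials and $'$ transposition of partitions. Here $s_{\mu'/\nu'}(b)$ in one variable equals $b^{|\mu|-|\nu|}$ if $\mu_j-\nu_j\in\{0,1\}$ for all $j$, and $0$ otherwise (with $0^0=1$). *)

(* Defs.v *)
From HB Require Import structures.
From mathcomp Require Import all_boot all_order all_algebra.
From mathcomp Require Import all_classical all_reals all_analysis.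

Set Implicit Arguments.
Unset Strict Implicit.
Unset Printing Implicit Defensive.

Import Order.TTheory GRing.Theory Num.Theory.
Import numFieldNormedType.Exports.

Local Open Scope classical_set_scope.
Local Open Scope ring_scope.

(* The number of variables is N = n.+1, and all indices are shifted to start
   at 0: lambda_1, ..., lambda_N become l ord0, ..., l ord_max, and
   beta_1, ..., beta_{N-1} become the values of beta : 'I_n -> R. *)

Definition is_part N (l : {ffun 'I_N -> nat}) : bool :=
  [forall i : 'I_N, forall j : 'I_N, (i <= j)%N ==> (l j <= l i)%N].

Record part N := Part { parts :> {ffun 'I_N -> nat}; _ : is_part parts }.
HB.instance Definition _ N := [isSub for @parts N].
HB.instance Definition _ N := [Countable of part N by <:].

Definition psize N (l : part N) : nat := (\sum_i l i)%N.

Section Polynomials.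
Context {R : realType}.

Definition generic N : set 'rV[R]_N :=
  [set z | injective (z ord0) /\ forall i, z ord0 i != 0].

Definition alternant_ratio N (f : 'I_N -> R -> R) (z : 'rV[R]_N) : R :=
  \det (\matrix_(i < N, j < N) f j (z ord0 i))
  / \prod_(i < N) \prod_(j < N | (i < j)%N) (z ord0 i - z ord0 j).

(* The determinant ratio extended by continuity from the points with distinct
   nonzero coordinates. *)
Definition alternant N (f : 'I_N -> R -> R) (x : 'rV[R]_N) : R :=
  lim (alternant_ratio f z @[z --> within (@generic N) (nbhs x)]).

Definition schur n (l : part n.+1) : 'rV[R]_n.+1 -> R :=
  alternant (fun j t => t ^+ (l j + (n - j))).

Definition groth n (beta : 'I_n -> R) (l : part n.+1) : 'rV[R]_n.+1 -> R :=
  alternant (fun j t =>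
    t ^+ (l j + (n - j)) * \prod_(r < n | (r < j)%N) (1 - beta r * t)).

Definition groth_dual n (beta : 'I_n -> R) (l : part n.+1) :
    'rV[R]_n.+1 -> R :=
  alternant (fun j t =>
    t ^+ (l j + (n - j)) * \prod_(r < n | (j <= r)%N) (1 - beta r * t^-1)).

(* The one-variable skew Schur polynomial s_{mu'/nu'}(b) of the transposed
   partitions. *)
Definition skew_schur_tr N (mu nu : part N) (b : R) : R :=
  if [forall j, (mu j == nu j) || (mu j == (nu j).+1)]
  then b ^+ (psize mu - psize nu) else 0.

Definition groth_measure n (x y : 'rV[R]_n.+1) (beta : 'I_n -> R)
    (l : part n.+1) : R :=
  (\prod_(i < n.+1) \prod_(j < n.+1) (1 - x ord0 i * y ord0 j))
  / (\prod_(i < n.+1) \prod_(r < n) (1 - x ord0 i * beta r))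
  * groth beta l x * groth_dual beta l y.

Definition schur_weight n (x y : 'rV[R]_n.+1) (beta : 'I_n -> R)
    (mu : {ffun 'I_n.+1 -> part n.+1}) : R :=
  schur (mu ord0) x
  * (\prod_(r < n) skew_schur_tr (mu (widen_ord (leqnSn n) r))
                                 (mu (lift ord0 r)) (- beta r))
  * schur (mu ord_max) y.

(* If the sum of the weights were infinite, fine would send it to 0 and
   schur_process would vanish identically, so is_pmf below would fail. *)
Definition schur_process n (x y : 'rV[R]_n.+1) (beta : 'I_n -> R)
    (mu : {ffun 'I_n.+1 -> part n.+1}) : R :=
  schur_weight x y beta mu
  / fine (\esum_(nu in setT) (schur_weight x y beta nu)%:E).

Definition is_pmf (T : choiceType) (p : T -> R) : Prop :=
  (forall t, 0 <= p t) /\ \esum_(t in setT) (p t)%:E = 1%:E.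

(* The law of f(t) when t has probability mass function p. *)
Definition law_of (T : choiceType) (U : Type) (p : T -> R) (f : T -> U)
    (A : set U) : \bar R :=
  \esum_(t in f @^-1` A) (p t)%:E.

End Polynomials.

(* Main.v *)
(** The columns of the two determinants are products of linear factors. Expanding
    one factor at a time by multilinearity writes [groth beta l x] as a sum of
    Schur polynomials over the triangular arrays of entries mu^i_j, i < j, with
    the diagonal l, and [groth_dual beta l y] as a similar sum over the entries
    with i > j: the terms whose rows fail to be partitions vanish, having two
    equal columns. Once the diagonal of (mu^1, ..., mu^N) is fixed, the entries
    above and below it can be chosen independently, so the product of these two
    sums is the total Schur process weight of the fiber over l.

    The total mass comes from the Cauchy identity. It is obtained for the
    branching-rule sums [tableau_sum], where every term is nonnegative, from the
    local growth rule of the Robinson-Schensted-Knuth correspondence; this also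
    gives it at points with equal or zero coordinates. *)

Require Import Defs.
From mathcomp Require Import all_boot all_order all_algebra.
From mathcomp Require Import all_classical all_reals all_analysis.
From mathcomp Require Import perm zify lra.

Set Implicit Arguments.
Unset Strict Implicit.
Unset Printing Implicit Defensive.

Import Order.TTheory GRing.Theory Num.Theory.
Import numFieldNormedType.Exports.

Local Open Scope classical_set_scope.
Local Open Scope ring_scope.

(** * Sums of nonnegative families *)

Section NonnegativeSums.
Context {R : realType}.

(** The sign conditions make every weight nonnegative, so all sums over arrays are taken in the
    extended reals and exchanged freely. Two points shape the argument. A row that is not a
    partition cancels only if two neighbouring columns agree in all the factors still left, not just
    in the power; this dictates the order in which the factors are removed, by decreasing index for
    [groth] and by increasing index for [groth_dual]. The two triangles decouple because the strip
    condition compares entries of one column only, while the inequalities of row i on the two sides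
    of the diagonal meet only at the diagonal entry, which is pinned to [l i]. Grothendieck
    polynomials get no Cauchy identity of their own: their normalization is read off from the
    equality of the two laws on the full set. *)

Lemma esumZl_ge0 (T : choiceType) (I : set T) (a : T -> \bar R) (c : R) :
  0 <= c -> (forall i, (0 <= a i)%E) ->
  \esum_(i in I) (c%:E * a i)%E = (c%:E * \esum_(i in I) a i)%E.
Proof.
move=> c0 a0; rewrite /esum -ereal_supZl //; last first.
  by apply/set0P; exists (\sum_(i \in set0) a i)%E; exists set0 => //;
    exact: fsets_set0.
congr ereal_sup; apply/seteqP; split => [_ [X [fX XI] <-]|_ [_ [X [fX XI] <-] <-]].
  by exists (\sum_(i \in X) a i)%E; [exists X|rewrite ge0_mule_fsumr].
by exists X => //; rewrite ge0_mule_fsumr.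
Qed.

(** Tonelli with dependent index sets, as needed when interlacing conditions tie the two indices. *)
Lemma exchange_esum (T1 T2 : choiceType) (I : set T1) (J : T1 -> set T2)
    (J' : set T2) (I' : T2 -> set T1) (a : T1 -> T2 -> \bar R) :
  (forall i j, I i -> J i j -> (0 <= a i j)%E) ->
  (forall i j, I i /\ J i j <-> J' j /\ I' j i) ->
  \esum_(i in I) \esum_(j in J i) a i j =
  \esum_(j in J') \esum_(i in I' j) a i j.
Proof.
move=> a0 IJ; rewrite !esum_esum //; last by move=> j i J'j I'ji; apply: a0;
  apply (IJ i j).
rewrite (@reindex_esum _ _ _ (J' `*`` I') (I `*`` J) (fun k => (k.2, k.1))) //.
split=> [[j i] /= /IJ//|[j i] [j' i'] _ _ /= [-> ->]//|[i j] /= /IJ ij].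
by exists (j, i).
Qed.

Lemma esum_finType (T : finType) (P : pred T) (F : T -> R) :
  (forall t, P t -> 0 <= F t) ->
  \esum_(t in [set t | P t]) (F t)%:E = (\sum_(t | P t) F t)%:E.
Proof.
move=> F0; rewrite esum_fset; [|exact: finite_finset|by move=> t;
  rewrite inE lee_fin; exact: F0].
by rewrite -sumEFin (@bigfs _ _ _ _ _ P) ?index_enum_uniq // => t;
  rewrite mem_index_enum.
Qed.

Lemma esum_prod (T1 T2 : choiceType) (I : set T1) (J : set T2)
    (f : T1 -> R) (g : T2 -> R) (a b : R) :
  (forall i, 0 <= f i) -> (forall j, 0 <= g j) ->
  \esum_(i in I) (f i)%:E = a%:E -> \esum_(j in J) (g j)%:E = b%:E ->
  \esum_(k in I `*` J) (f k.1 * g k.2)%:E = (a * b)%:E.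
Proof.
move=> f0 g0 fa gb; rewrite -(@esum_esum _ _ _ I (fun=> J) (fun i j =>
  (f i * g j)%:E)); last first.
  by move=> i j _ _; rewrite lee_fin mulr_ge0.
rewrite mulrC EFinM -fa -esumZl_ge0 // -?lee_fin -?gb;
  last by apply: esum_ge0 => j _; rewrite lee_fin.
by apply: eq_esum => i _; rewrite gb -EFinM mulrC EFinM -gb -esumZl_ge0.
Qed.

Lemma esum_geometric (q : R) : 0 <= q -> q < 1 ->
  \esum_(k in [set: nat]) (q ^+ k)%:E = ((1 - q)^-1)%:E.
Proof.
move=> q0 q1; rewrite -nneseries_esumT; last by move=> k; rewrite lee_fin exprn_ge0.
have sE : series (fun k => q ^+ k) = series (geometric 1 q).
  by apply/funext => k /=; apply: eq_bigr => i _; rewrite /= mul1r.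
apply/cvg_lim => //; rewrite (_ : (fun m => _) = EFin \o series (fun k => q ^+ k)).
  apply: cvg_EFin; first exact: nearW.
  rewrite (_ : fine \o _ = series (geometric 1 q)); last by rewrite -sE.
  rewrite -[(1 - q)^-1]mul1r; apply: cvg_geometric_series; rewrite ger0_norm //.
by apply/funext => k /=; rewrite sumEFin.
Qed.

End NonnegativeSums.

(** * Weighted paths and transfer kernels *)

Section PathSums.
Context {R : realType} {T : choiceType}.
Variables (f : T -> R) (K : nat -> T -> T -> R).
Hypotheses (f_ge0 : forall t, 0 <= f t) (K_ge0 : forall k t t', 0 <= K k t t').

(** An unnormalized Markov chain with initial weight [f] and transitions [K r]. The Schur process
    and both kinds of triangular arrays are instances. *)
Definition path_weight m (mu : {ffun 'I_m.+1 -> T}) : R :=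
  f (mu ord0)
  * \prod_(r < m) K r (mu (widen_ord (leqnSn m) r)) (mu (lift ord0 r)).

Lemma path_weight_ge0 m (mu : {ffun 'I_m.+1 -> T}) : 0 <= path_weight mu.
Proof. by rewrite mulr_ge0 // prodr_ge0. Qed.

Definition ffun_rcons m (mu : {ffun 'I_m.+1 -> T}) (t : T) :
    {ffun 'I_m.+2 -> T} :=
  [ffun i => oapp mu t (unlift ord_max i)].

Lemma ffun_rcons_max m (mu : {ffun 'I_m.+1 -> T}) t :
  ffun_rcons mu t ord_max = t.
Proof. by rewrite ffunE unlift_none. Qed.

Lemma ffun_rcons_lift m (mu : {ffun 'I_m.+1 -> T}) t i :
  ffun_rcons mu t (lift ord_max i) = mu i.
Proof. by rewrite ffunE liftK. Qed.

Lemma path_weight_rcons m (mu : {ffun 'I_m.+1 -> T}) t :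
  path_weight (ffun_rcons mu t) = path_weight mu * K m (mu ord_max) t.
Proof.
have wE (i : 'I_m.+1) : widen_ord (leqnSn m.+1) i = lift ord_max i.
  by apply: val_inj; rewrite /= /bump leqNgt ltn_ord.
rewrite /path_weight big_ord_recr /= mulrA; congr (_ * _ * _).
- by rewrite (_ : ord0 = lift ord_max ord0) ?ffun_rcons_lift //; apply: val_inj.
- apply: eq_bigr => r _; rewrite -(ffun_rcons_lift mu t) -(ffun_rcons_lift mu t (lift
  ord0 r)).
  congr (K _ (ffun_rcons mu t _) (ffun_rcons mu t _)); apply: val_inj => //=.
    by rewrite /bump leqNgt (ltn_trans (ltn_ord r)).
  by rewrite /bump /= !add1n leqNgt ltnS ltn_ord.
- rewrite wE ffun_rcons_lift; congr K.
  by rewrite (_ : lift ord0 _ = ord_max) ?ffun_rcons_max //; apply: val_inj.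
Qed.

Lemma esum_ffun_recr m (F : {ffun 'I_m.+2 -> T} -> \bar R) :
  (forall mu, (0 <= F mu)%E) ->
  \esum_(mu in [set: {ffun 'I_m.+2 -> T}]) F mu =
  \esum_(mu in [set: {ffun 'I_m.+1 -> T}]) \esum_(t in [set: T])
    F (ffun_rcons mu t).
Proof.
move=> F0; rewrite (esum_esum (J := fun=> setT)) //.
apply: (reindex_esum _ _ (fun k => ffun_rcons k.1 k.2)); split => //.
- move=> [mu t] [mu' t'] _ _ /= /ffunP e; congr pair.
    by apply/ffunP => i; have := e (lift ord_max i); rewrite !ffun_rcons_lift.
  by have := e ord_max; rewrite !ffun_rcons_max.
- move=> mu _; exists ([ffun i => mu (lift ord_max i)], mu ord_max) => //=.
  apply/ffunP => i; rewrite ffunE; case: unliftP => [j ->|->] //=.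
  by rewrite ffunE.
Qed.

Lemma esum_ffun1 (F : {ffun 'I_1 -> T} -> \bar R) :
  \esum_(mu in [set: {ffun 'I_1 -> T}]) F mu =
  \esum_(t in [set: T]) F [ffun=> t].
Proof.
apply: (reindex_esum _ _ (fun t => [ffun=> t])); split => //.
- by move=> t t' _ _ /ffunP /(_ ord0); rewrite !ffunE.
- by move=> mu _; exists (mu ord0) => //; apply/ffunP => i; rewrite ffunE (ord1 i).
Qed.

(** [V k] is the total weight of the paths of k steps with a given endpoint. The induction removes
    the last step and absorbs its kernel into the test function [g]. *)
Lemma esum_path_forward (V : nat -> T -> R) m (g : T -> R) :
  (forall k t, 0 <= V k t) -> (forall t, 0 <= g t) -> V 0%N =1 f ->
  (forall k t', (k < m)%N ->
     \esum_(t in [set: T]) (V k t * K k t t')%:E = (V k.+1 t')%:E) ->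
  \esum_(mu in [set: {ffun 'I_m.+1 -> T}])
     (path_weight mu * g (mu ord_max))%:E =
  \esum_(t in [set: T]) (V m t * g t)%:E.
Proof.
move=> V0 + Vf; elim: m g => [|m IH] g g0 VS.
  rewrite esum_ffun1; apply: eq_esum => t _.
  by rewrite /path_weight big_ord0 mulr1 Vf !ffunE.
rewrite esum_ffun_recr; last by move=> mu; rewrite lee_fin mulr_ge0 ?path_weight_ge0.
rewrite (exchange_esum (J' := setT) (I' := fun=> setT)) //; last first.
  by move=> mu t _ _; rewrite lee_fin mulr_ge0 ?path_weight_ge0.
apply: eq_esum => t' _.
under eq_esum do rewrite path_weight_rcons ffun_rcons_max mulrC EFinM.
rewrite esumZl_ge0 //; last by move=> mu; rewrite lee_fin mulr_ge0 ?path_weight_ge0.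
rewrite (IH (fun t => K m t t')) //; last by move=> k t km; apply: VS;
  rewrite ltnS ltnW.
by rewrite VS // -EFinM mulrC.
Qed.

(** [D k] is the total weight of all continuations from step k; the last step is summed out
    first. *)
Lemma esum_path_backward (D : nat -> T -> R) m :
  (forall k t, 0 <= D k t) ->
  (forall k t, (k < m)%N ->
     \esum_(t' in [set: T]) (K k t t' * D k.+1 t')%:E = (D k t)%:E) ->
  \esum_(mu in [set: {ffun 'I_m.+1 -> T}])
     (path_weight mu * D m (mu ord_max))%:E =
  \esum_(t in [set: T]) (f t * D 0%N t)%:E.
Proof.
move=> D0; elim: m => [|m IH] DS.
  rewrite esum_ffun1; apply: eq_esum => t _.
  by rewrite /path_weight big_ord0 mulr1 !ffunE.
rewrite esum_ffun_recr; last by move=> mu; rewrite lee_fin mulr_ge0 ?path_weight_ge0.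
rewrite -IH; last by move=> k t km; apply: DS; rewrite ltnS ltnW.
apply: eq_esum => mu _; rewrite EFinM -DS // -esumZl_ge0 ?path_weight_ge0 //;
  last first.
  by move=> t; rewrite lee_fin mulr_ge0.
by apply: eq_esum => t _; rewrite path_weight_rcons ffun_rcons_max -mulrA EFinM.
Qed.

End PathSums.

(** * Interlacing partitions and the Cauchy identity *)

Section Interlacing.
Variable n : nat.
Implicit Types l v : {ffun 'I_n.+1 -> nat}.

Definition weight N (l : {ffun 'I_N -> nat}) : nat := (\sum_i l i)%N.

(* [interlace l v] says that l/v is a horizontal strip:
   l_0 >= v_0 >= l_1 >= v_1 >= ... *)
Definition interlace l v : bool :=
  [forall i, (v i <= l i)%N]
  && [forall j : 'I_n, (l (lift ord0 j) <= v (lift ord_max j))%N].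

Lemma interlaceP l v :
  reflect ((forall i, (v i <= l i)%N) /\
           forall j : 'I_n, (l (lift ord0 j) <= v (lift ord_max j))%N)
          (interlace l v).
Proof. by apply: (iffP andP) => -[/forallP ? /forallP]. Qed.

(** Neighbouring parts suffice. Here and below [lift ord_max j] and [lift ord0 j] are the indices j
    and j+1, so pairs of neighbours are indexed by ['I_n]. *)
Lemma is_partP l :
  reflect (forall j : 'I_n, (l (lift ord0 j) <= l (lift ord_max j))%N)
          (is_part l).
Proof.
apply: (iffP forallP) => [lP j|lS i].
  have /forallP/(_ (lift ord0 j))/implyP := lP (lift ord_max j); apply.
  by rewrite lift0 lift_max.
apply/forallP => j; apply/implyP;
  move: (nat_of_ord j) {-2}j (erefl (nat_of_ord j)) => {}j.
elim: j => [|j IH] k kE; first by rewrite kE leqn0 => /eqP i0;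
  rewrite (_ : i = k) //; apply: ord_inj; rewrite kE.
rewrite kE leq_eqVlt ltnS => /orP[/eqP ij|ij]; first by rewrite (_ : i = k) //;
  apply: ord_inj; rewrite kE.
have jn : (j < n)%N by have := ltn_ord k; rewrite kE ltnS.
have -> : k = lift ord0 (Ordinal jn) by apply: ord_inj; rewrite lift0 kE.
have jE : nat_of_ord (lift ord_max (Ordinal jn)) = j by rewrite lift_max.
by apply: (leq_trans (lS _)); apply: IH; rewrite ?jE.
Qed.

Lemma interlace_part l v : interlace l v -> is_part l /\ is_part v.
Proof.
move=> /interlaceP[vl lv]; split; apply/is_partP => j.
  exact: leq_trans (lv j) (vl _).
exact: leq_trans (vl _) (lv j).
Qed.

Lemma sum_lift_max (F : 'I_n.+1 -> nat) :
  (\sum_i F i = \sum_(j < n) F (lift ord_max j) + F ord_max)%N.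
Proof.
rewrite big_ord_recr /=; congr (_ + _)%N; apply: eq_bigr => j _.
by congr F; apply: ord_inj; rewrite lift_max.
Qed.

Lemma weight_le l v : (forall i, (v i <= l i)%N) -> (weight v <= weight l)%N.
Proof. by move=> vl; apply: leq_sum. Qed.

End Interlacing.

Lemma ord_caseS0 n (i : 'I_n.+1) : (exists j : 'I_n, i = lift ord0 j) \/ i = ord0.
Proof. by case: (unliftP ord0 i) => [j ->|->]; [left; exists j|right]. Qed.

Lemma ord_caseS_max n (i : 'I_n.+1) : (exists j : 'I_n, i = lift ord_max j) \/ i =
  ord_max.
Proof. by case: (unliftP ord_max i) => [j ->|->]; [left; exists j|right]. Qed.

(* The hypothesis of [ffunP] is stated over a dependent codomain, which hides
   the type [nat] from [lia]. *)
Lemma eq_natffun n (l v : {ffun 'I_n -> nat}) :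
  (forall i : 'I_n, l i = v i) -> l = v.
Proof. by move=> lv; apply/ffunP. Qed.

Section LocalRule.
Context {R : realType}.
Variable n : nat.
Implicit Types l v mu nu kap : {ffun 'I_n.+1 -> nat}.

(* The local growth rule of the Robinson-Schensted-Knuth correspondence. *)
Definition grow mu nu kap (k : nat) : {ffun 'I_n.+1 -> nat} :=
  [ffun i => oapp (fun j : 'I_n =>
      minn (mu (lift ord_max j)) (nu (lift ord_max j))
      + maxn (mu (lift ord0 j)) (nu (lift ord0 j)) - kap (lift ord_max j))%N
    (maxn (mu ord0) (nu ord0) + k)%N (unlift ord0 i)].

(** The inverse of [grow] in the variable [kap], by the same reflections; the last entry is 0
    because it is bounded by [mu ord_max], which is 0 in the application. *)
Definition shrink mu nu l : {ffun 'I_n.+1 -> nat} :=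
  [ffun i => oapp (fun j : 'I_n =>
      minn (mu (lift ord_max j)) (nu (lift ord_max j))
      + maxn (mu (lift ord0 j)) (nu (lift ord0 j)) - l (lift ord0 j))%N
    0%N (unlift ord_max i)].

Lemma grow0 mu nu kap k : grow mu nu kap k ord0 = (maxn (mu ord0) (nu ord0) + k)%N.
Proof. by rewrite ffunE unlift_none. Qed.

Lemma growS mu nu kap k j : grow mu nu kap k (lift ord0 j) =
  (minn (mu (lift ord_max j)) (nu (lift ord_max j))
      + maxn (mu (lift ord0 j)) (nu (lift ord0 j)) - kap (lift ord_max j))%N.
Proof. by rewrite ffunE liftK. Qed.

Lemma shrink_max mu nu l : shrink mu nu l ord_max = 0%N.
Proof. by rewrite ffunE unlift_none. Qed.

Lemma shrink_lift mu nu l j : shrink mu nu l (lift ord_max j) =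
  (minn (mu (lift ord_max j)) (nu (lift ord_max j))
      + maxn (mu (lift ord0 j)) (nu (lift ord0 j)) - l (lift ord0 j))%N.
Proof. by rewrite ffunE liftK. Qed.

(** For fixed mu and nu, the entries kap_j and l_(j+1) range over the same interval, from
    max(mu_(j+1), nu_(j+1)) to min(mu_j, nu_j), and the rule is the reflection of that interval. The
    entry l_0 is bounded only from below, by max(mu_0, nu_0), and k is its excess; kap_n is at most
    mu_n = 0. *)
Lemma grow_bij mu nu : mu ord_max = 0%N ->
  set_bij ([set kap | interlace mu kap && interlace nu kap] `*` [set: nat])
    [set l | interlace l mu && interlace l nu]
    (fun p => grow mu nu p.1 p.2).
Proof.
move=> mu0; split.
- move=> [kap k] [/= /andP[/interlaceP[km mk] /interlaceP[kn nk]] _].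
  apply/andP; split; apply/interlaceP; split.
  + move=> i; case: (ord_caseS0 i) => [[j ->]|->]; rewrite ?grow0 ?growS; last lia.
    by move: (km (lift ord_max j)) (mk j) (kn (lift ord_max j)) (nk j); lia.
  + move=> j; rewrite growS.
    by move: (km (lift ord_max j)) (mk j) (kn (lift ord_max j)) (nk j); lia.
  + move=> i; case: (ord_caseS0 i) => [[j ->]|->]; rewrite ?grow0 ?growS; last lia.
    by move: (km (lift ord_max j)) (mk j) (kn (lift ord_max j)) (nk j); lia.
  + move=> j; rewrite growS.
    by move: (km (lift ord_max j)) (mk j) (kn (lift ord_max j)) (nk j); lia.
- move=> [kap k] [kap' k'] /set_mem[/= /andP[/interlaceP[km mk] /interlaceP[kn nk]] _].
  move=> /set_mem[/= /andP[/interlaceP[km' mk'] /interlaceP[kn' nk']] _] /ffunP e.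
  congr pair; last by have : _ = _ :> nat := e ord0; rewrite !grow0; lia.
  apply: eq_natffun => i; case: (ord_caseS_max i) => [[j ->]|->].
    have : _ = _ :> nat := e (lift ord0 j); rewrite !growS.
    move: (km (lift ord_max j)) (mk j) (kn (lift ord_max j)) (nk j).
    by move: (km' (lift ord_max j)) (mk' j) (kn' (lift ord_max j)) (nk' j); lia.
  by move: (km ord_max) (km' ord_max); lia.
- move=> l /= /andP[/interlaceP[ml lm] /interlaceP[nl ln]].
  exists (shrink mu nu l, l ord0 - maxn (mu ord0) (nu ord0))%N => /=.
    split=> //=; apply/andP; split; apply/interlaceP; split.
    + move=> i; case: (ord_caseS_max i) => [[j ->]|->];
      rewrite ?shrink_max // shrink_lift.
      by move: (ml (lift ord0 j)) (lm j) (nl (lift ord0 j)) (ln j); lia.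
    + move=> j; rewrite shrink_lift.
      by move: (ml (lift ord0 j)) (lm j) (nl (lift ord0 j)) (ln j); lia.
    + move=> i; case: (ord_caseS_max i) => [[j ->]|->];
      rewrite ?shrink_max // shrink_lift.
      by move: (ml (lift ord0 j)) (lm j) (nl (lift ord0 j)) (ln j); lia.
    + move=> j; rewrite shrink_lift.
      by move: (ml (lift ord0 j)) (lm j) (nl (lift ord0 j)) (ln j); lia.
  apply: eq_natffun => i; case: (ord_caseS0 i) => [[j ->]|->].
    rewrite growS shrink_lift.
    by move: (ml (lift ord0 j)) (lm j) (nl (lift ord0 j)) (ln j); lia.
  by rewrite grow0; move: (ml ord0) (nl ord0); lia.
Qed.

(** A reflection fixes each sum kap_j + l_(j+1), and a minimum and a maximum add up to the two
    entries, so only k changes the total. *)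
Lemma weight_grow mu nu kap k : mu ord_max = 0%N ->
  interlace mu kap -> interlace nu kap ->
  (weight (grow mu nu kap k) + weight kap = weight mu + weight nu + k)%N.
Proof.
move=> mu0 /interlaceP[km mk] /interlaceP[kn nk].
have -> : (weight mu + weight nu =
    \sum_i minn (mu i) (nu i) + \sum_i maxn (mu i) (nu i))%N.
  by rewrite /weight -!big_split; apply: eq_bigr => i _ /=; lia.
have k0 : kap ord_max = 0%N by have := km ord_max; lia.
rewrite /weight big_ord_recl grow0 (sum_lift_max kap) k0 addn0.
rewrite (sum_lift_max (fun i => minn (mu i) (nu i))) mu0 min0n addn0.
rewrite (big_ord_recl _ (fun i => maxn (mu i) (nu i))).
suff : (\sum_(j < n) grow mu nu kap k (lift ord0 j) + \sum_(j < n) kap (lift ord_max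
  j) =
  \sum_(j < n) minn (mu (lift ord_max j)) (nu (lift ord_max j)) +
  \sum_(j < n) maxn (mu (lift ord0 j)) (nu (lift ord0 j)))%N by lia.
rewrite -!big_split; apply: eq_bigr => j _ /=; rewrite growS.
by move: (km (lift ord_max j)) (mk j) (kn (lift ord_max j)) (nk j); lia.
Qed.

(** Along [grow_bij] both exponents increase by k, and the sum over k is the geometric series of x *
    y. *)
Lemma skew_cauchy1 (x y : R) mu nu : 0 <= x -> 0 <= y -> x * y < 1 ->
  mu ord_max = 0%N ->
  \esum_(l in [set l | interlace l mu && interlace l nu])
    (x ^+ (weight l - weight mu) * y ^+ (weight l - weight nu))%:E =
  (((1 - x * y)^-1)%:E *
  \esum_(kap in [set kap | interlace mu kap && interlace nu kap])
    (x ^+ (weight nu - weight kap) * y ^+ (weight mu - weight kap))%:E)%E.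
Proof.
move=> x0 y0 xy1 mu0; have xy0 : 0 <= x * y by rewrite mulr_ge0.
rewrite (reindex_esum _ _ _ _ (grow_bij nu mu0)).
rewrite -esumZl_ge0 ?invr_ge0 ?subr_ge0 ?(ltW xy1) //; last first.
  by move=> kap; rewrite lee_fin mulr_ge0 ?exprn_ge0.
rewrite -(@esum_esum _ _ _ _ (fun=> setT) (fun kap k =>
   (x ^+ (weight (grow mu nu kap k) - weight mu)
     * y ^+ (weight (grow mu nu kap k) - weight nu))%:E)); last first.
  by move=> kap k _ _; rewrite lee_fin mulr_ge0 ?exprn_ge0.
apply: eq_esum => kap /= /andP[mk nk].
rewrite -esum_geometric // muleC -esumZl_ge0 ?mulr_ge0 ?exprn_ge0 //; last first.
  by move=> k; rewrite lee_fin exprn_ge0.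
apply: eq_esum => k _; rewrite -EFinM; congr EFin.
have wE := weight_grow k mu0 mk nk.
have [/interlaceP[/weight_le mle _] /interlaceP[/weight_le nle _]] := (mk, nk).
have -> : (weight (grow mu nu kap k) - weight mu = k + (weight nu - weight kap))%N by
  lia.
have -> : (weight (grow mu nu kap k) - weight nu = k + (weight mu - weight kap))%N by
  lia.
by rewrite !exprD exprMn; lra.
Qed.

End LocalRule.

(** * Schur polynomials by the branching rule *)

Section TableauSum.
Context {R : realType}.

(* The Schur polynomial of [l] in the variables y_0, ..., y_(m-1), computed by
   the branching rule that removes the last variable. *)
Fixpoint tableau_sum (y : nat -> R) m : {ffun 'I_m -> nat} -> R :=
  match m return {ffun 'I_m -> nat} -> R with
  | 0 => fun=> 1
  | m'.+1 => fun l =>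
    \sum_(f : {ffun 'I_m' -> 'I_(l ord0).+1} |
          [forall j, (l (lift ord0 j) <= f j <= l (lift ord_max j))%N])
      y m' ^+ (weight l - \sum_j f j) * tableau_sum y [ffun j => f j : nat]
  end.

Lemma tableau_sum_ge0 (y : nat -> R) m (l : {ffun 'I_m -> nat}) :
  (forall i, 0 <= y i) -> 0 <= tableau_sum y l.
Proof.
move=> y0; elim: m l => [|m IH] l //=.
by apply: sumr_ge0 => f _; rewrite mulr_ge0 ?exprn_ge0.
Qed.

Section Padding.
Variable n : nat.
Implicit Types l v : {ffun 'I_n.+1 -> nat}.

(** [tableau_sum] in m variables takes shapes of length m, but the Cauchy identity lets m vary; zero
    padding puts all shapes in one type. *)
Definition trunc m l : {ffun 'I_m -> nat} := [ffun i : 'I_m => l (inord i)].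

Definition pad m (f : {ffun 'I_m -> nat}) : {ffun 'I_n.+1 -> nat} :=
  [ffun i : 'I_n.+1 => oapp f 0%N (insub (i : nat))].

Definition supported m l : bool :=
  [forall i : 'I_n.+1, (m <= i)%N ==> (l i == 0%N)].

Lemma supportedP m l :
  reflect (forall i : 'I_n.+1, (m <= i)%N -> l i = 0%N) (supported m l).
Proof.
apply: (iffP forallP) => [h i mi|h i]; first by apply/eqP/(implyP (h i)).
by apply/implyP => /h ->.
Qed.

Lemma pad_lt m (f : {ffun 'I_m -> nat}) (i : 'I_n.+1) (im : (i < m)%N) :
  pad f i = f (Ordinal im).
Proof. by rewrite ffunE insubT. Qed.

Lemma pad_ge m (f : {ffun 'I_m -> nat}) (i : 'I_n.+1) : (m <= i)%N -> pad f i = 0%N.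
Proof. by move=> mi; rewrite ffunE insubN // -leqNgt. Qed.

Lemma trunc_pad m (f : {ffun 'I_m -> nat}) : (m <= n.+1)%N -> trunc m (pad f) = f.
Proof.
move=> mn; apply: eq_natffun => i; rewrite ffunE.
have iE : nat_of_ord (inord i : 'I_n.+1) = i by rewrite inordK // (leq_trans _ mn).
have im : ((inord i : 'I_n.+1) < m)%N by rewrite iE.
by rewrite (pad_lt f im); congr (f _); apply: ord_inj.
Qed.

Lemma pad_trunc m l : supported m l -> pad (trunc m l) = l.
Proof.
move/supportedP => lm; apply: eq_natffun => i; case: (ltnP i m) => im.
  by rewrite (pad_lt _ im) ffunE /= inord_val.
by rewrite pad_ge // lm.
Qed.

Lemma weight_pad m (f : {ffun 'I_m -> nat}) : (m <= n.+1)%N -> weight (pad f) =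
  weight f.
Proof.
move=> mn; rewrite /weight -{2}(trunc_pad f mn).
under [RHS]eq_bigr do rewrite ffunE.
rewrite (big_ord_widen _ (fun i => pad f (inord i)) mn) [RHS]big_mkcond /=.
by apply: eq_bigr => i _; rewrite inord_val; case: ltnP => // /pad_ge ->.
Qed.

Lemma trunc_full l : trunc n.+1 l = l.
Proof. by apply: eq_natffun => i; rewrite ffunE inord_val. Qed.

(* The Schur polynomial of a partition with n.+1 parts in the first m variables;
   it vanishes when more than m parts are nonzero. *)
Definition schurc (y : nat -> R) m l : R :=
  if is_part l && supported m l then tableau_sum y (trunc m l) else 0.

Lemma schurc_ge0 (y : nat -> R) m l : (forall i, 0 <= y i) -> 0 <= schurc y m l.
Proof. by move=> y0; rewrite /schurc; case: ifP => // _; exact: tableau_sum_ge0. Qed.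

Lemma schurc_full (y : nat -> R) l : is_part l -> schurc y n.+1 l = tableau_sum y l.
Proof.
move=> lP; rewrite /schurc lP trunc_full; case: supportedP => // -[] i.
by rewrite leqNgt ltn_ord.
Qed.

Lemma trunc_interlace_bij m l : (m <= n)%N -> is_part l -> supported m.+1 l ->
  set_bij [set f : {ffun 'I_m -> 'I_(trunc m.+1 l ord0).+1} |
            [forall j, (trunc m.+1 l (lift ord0 j) <= f j
                        <= trunc m.+1 l (lift ord_max j))%N]]
    [set v | interlace l v && supported m v]
    (fun f => pad [ffun j => f j : nat]).
Proof.
move=> mn lP /supportedP ls.
have lt j : (j < m)%N -> (j < n.+1)%N by move=> jm; rewrite (ltn_trans jm).
have tl0 (j : 'I_m) (jn : (j < n)%N) : trunc m.+1 l (lift ord0 j) = l (lift ord0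
  (Ordinal jn)).
  by rewrite ffunE; congr (l _); apply: ord_inj; rewrite inordK !lift0 // ltnS.
have tlm (j : 'I_m) : trunc m.+1 l (lift ord_max j) = l (inord j).
  by rewrite ffunE; congr (l _); apply: ord_inj; rewrite lift_max.
split.
- move=> f /= /forallP fP; apply/andP; split; last first.
    by apply/supportedP => i mi; rewrite pad_ge.
  apply/interlaceP; split=> [i|j].
    case: (ltnP i m) => im; last by rewrite pad_ge.
    rewrite (pad_lt _ im) ffunE; have /andP[_] := fP (Ordinal im).
    by rewrite tlm inord_val.
  case: (ltnP j m) => jm; last by rewrite ls // lift0.
  have jm' : (lift ord_max j < m)%N by rewrite lift_max.
  rewrite (pad_lt _ jm') ffunE; have /andP[+ _] := fP (Ordinal jm').
  have jn : (Ordinal jm' < n)%N by exact: leq_trans jm' mn.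
  by rewrite (tl0 _ jn); congr (l _ <= _)%N; apply: ord_inj; rewrite !lift0; congr S;
    exact: lift_max.
- move=> f g _ _ /(congr1 (trunc m)); rewrite !trunc_pad ?(leq_trans mn) // => e.
  apply/ffunP => j; apply: ord_inj;
    move: e => /(congr1 (fun h : {ffun _ -> nat} => h j)) /=; rewrite ffunE => ->;
    by rewrite ffunE.
- move=> v /= /andP[/interlaceP[vl lv] vs].
  have vb (j : 'I_m) : (v (inord j) < (trunc m.+1 l ord0).+1)%N.
    rewrite ltnS ffunE (leq_trans (vl _)) //.
    have /forallP/(_ (inord j))/implyP := forallP lP (inord (ord0 : 'I_m.+1)); apply.
    by rewrite inordK.
  pose f : {ffun 'I_m -> 'I_(trunc m.+1 l ord0).+1} := [ffun j : 'I_m =>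
    inord (v (inord j))].
  have fE (j : 'I_m) : f j = v (inord j) :> nat.
    by rewrite (_ : f j = inord (v (inord j))) ?inordK //; exact: ffunE.
  exists f; last first.
    by rewrite -[RHS](pad_trunc vs); congr pad; apply: eq_natffun => j;
      rewrite [LHS]ffunE [RHS]ffunE fE.
  apply/forallP => j; have jn : (j < n)%N by rewrite (leq_trans (ltn_ord j)).
  rewrite fE tlm (tl0 _ jn) vl andbT (leq_trans (lv _)) //.
  by apply: eq_leq; congr (v _); apply: ord_inj; rewrite lift_max inordK // lt.
Qed.

(** The branching rule with the only constraint [interlace l v]: the support conditions are carried
    by the vanishing of [schurc]. This is the form in which sums over l and v can be exchanged. *)
Lemma schurc_rec (y : nat -> R) m l : (forall i, 0 <= y i) -> (m <= n)%N ->
  (schurc y m.+1 l)%:E = \esum_(v in [set v | interlace l v])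
     (y m ^+ (weight l - weight v) * schurc y m v)%:E.
Proof.
move=> y0 mn; rewrite {1}/schurc; case: ifPn => [/andP[lP ls]|lN]; last first.
  rewrite esum1 // => v /= lv; have [lP vP] := interlace_part lv.
  move: lN; rewrite lP /= /schurc vP /=; case: ifPn; last by rewrite mulr0.
  (* If v had only m rows, l_(j+1) <= v_j = 0 for j >= m would leave l at most m+1 rows. *)
  move=> /supportedP vs /negP[]; apply/supportedP => i;
    case: (ord_caseS0 i) => [[j ->]|->] //.
  rewrite lift0 ltnS => mj; have /interlaceP[_ /(_ j)] := lv.
  by rewrite vs ?lift_max // leqn0 => /eqP.
rewrite [RHS](_ : _ = \esum_(v in [set v | interlace l v] `&` [set v | supported m v])
     (y m ^+ (weight l - weight v) * schurc y m v)%:E); last first.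
  rewrite [RHS]esum_mkcondr; apply: eq_esum => v _; case: ifPn => //.
  by rewrite notin_setE /= => /negP/negbTE vN; rewrite /schurc vN andbF mulr0.
rewrite (_ : _ `&` _ = [set v | interlace l v && supported m v]); last first.
  by apply/seteqP; split => v /= => [[-> ->]|/andP[]].
rewrite (reindex_esum _ _ _ _ (trunc_interlace_bij mn lP ls)).
rewrite esum_finType; last by move=> f _; rewrite mulr_ge0 ?exprn_ge0 ?schurc_ge0.
congr EFin; rewrite /=; apply: eq_bigr => f fP.
have := set_bij_homo (trunc_interlace_bij mn lP ls) fP => /= /andP[lf fs].
have [_ fP'] := interlace_part lf.
rewrite /schurc fP' fs /= trunc_pad ?weight_pad ?(leq_trans mn) //.
rewrite (_ : weight l = weight (trunc m.+1 l));
  last by rewrite -[RHS]weight_pad // pad_trunc.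
congr (y m ^+ (_ - _) * _).
by rewrite /weight; apply: eq_bigr => j _; rewrite [RHS]ffunE.
Qed.

Lemma schurc0 (y : nat -> R) l : schurc y 0 l = (l == [ffun=> 0%N])%:R.
Proof.
rewrite /schurc; case: eqP => [->|l0].
  rewrite (_ : is_part _ && _); first by [].
  by apply/andP; split; [apply/is_partP => j|apply/supportedP => j _]; rewrite !ffunE.
case: ifP => // /andP[_ /supportedP ls]; case: l0.
by apply: eq_natffun => i; rewrite ls // ffunE.
Qed.

Lemma weight0 : weight ([ffun=> 0%N] : {ffun 'I_n.+1 -> nat}) = 0%N.
Proof. by rewrite /weight big1 // => i; rewrite ffunE. Qed.

End Padding.
End TableauSum.

Lemma esum_delta {R : realType} (T : choiceType) (t0 : T) (F : T -> R) :
  (forall t, 0 <= F t) ->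
  \esum_(t in [set: T]) ((t == t0)%:R * F t)%:E = (F t0)%:E.
Proof.
move=> F0; rewrite -(@esum_set1 _ _ t0 (fun t => (F t)%:E)) ?lee_fin //.
rewrite [RHS]esum_mkcond; apply: eq_esum => t _.
case: ifPn => [/set_mem ->|]; first by rewrite eqxx mul1r.
by rewrite notin_setE /= => /eqP/negbTE ->; rewrite mul0r.
Qed.

(** * Pieri rule and Cauchy identity *)

Section Cauchy.
Context {R : realType}.
Variable n : nat.
Implicit Types (x y : nat -> R) (l v nu kap : {ffun 'I_n.+1 -> nat}).

(** The Pieri rule as a generating function in the strip size. Removing a horizontal strip weighted
    by [x m] and adding one weighted by y commute up to the factor (1 - x_m y)^-1, by
    [skew_cauchy1]; induction on m then collects one factor per variable. *)
Lemma pieri x (y : R) m nu :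
  (forall i, 0 <= x i) -> 0 <= y -> (forall i, (i < m)%N -> x i * y < 1) ->
  (m <= n.+1)%N ->
  \esum_(l in [set l | interlace l nu])
     (schurc x m l * y ^+ (weight l - weight nu))%:E =
  ((\prod_(i < m) (1 - x i * y)^-1) * schurc x m nu)%:E.
Proof.
move=> x0 y0; elim: m nu => [|m IH] nu xy1 mn.
  rewrite big_ord0 mul1r schurc0 esum_mkcond.
  transitivity (\esum_(l in [set: {ffun 'I_n.+1 -> nat}]) ((l == [ffun=> 0%N])%:R *
       ((interlace l nu)%:R * y ^+ (weight l - weight nu)))%:E).
    apply: eq_esum => l _; rewrite schurc0.
    rewrite (_ : (l \in _) = interlace l nu); last by apply/idP/idP; rewrite inE.
    by case: interlace; rewrite ?mul1r ?mul0r ?mulr0.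
  rewrite esum_delta; last by move=> l; rewrite mulr_ge0 ?exprn_ge0.
  rewrite weight0 sub0n mulr1; congr (_%:R)%:E; congr nat_of_bool.
  apply/interlaceP/eqP => [[h _]|->]; last by split=> i; rewrite !ffunE.
  by apply: eq_natffun => i; have := h i; rewrite ffunE leqn0 => /eqP.
have xy : x m * y < 1 by apply: xy1.
have c0 : 0 <= (1 - x m * y)^-1 by rewrite invr_ge0 subr_ge0 ltW.
have e0 (a b : R) k1 k2 : 0 <= a -> 0 <= b -> 0 <= a ^+ k1 * b ^+ k2.
  by move=> *; rewrite mulr_ge0 ?exprn_ge0.
transitivity (\esum_(l in [set l | interlace l nu]) \esum_(v in [set v | interlace l v])
   (y ^+ (weight l - weight nu) * (x m ^+ (weight l - weight v) * schurc x m v))%:E).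
  apply: eq_esum => l _; rewrite mulrC EFinM schurc_rec // -esumZl_ge0 ?exprn_ge0 //.
  by move=> v; rewrite lee_fin mulr_ge0 ?exprn_ge0 ?schurc_ge0.
rewrite (exchange_esum (J' := setT) (I' := fun v =>
  [set l | interlace l v && interlace l nu])); last 2 first.
- by move=> l v _ _; rewrite lee_fin !mulr_ge0 ?exprn_ge0 ?schurc_ge0.
- by move=> l v; split => /= [[-> ->]|[_ /andP[-> ->]]].
transitivity (\esum_(v in [set: {ffun 'I_n.+1 -> nat}])
   \esum_(kap in [set kap | interlace v kap && interlace nu kap])
   ((1 - x m * y)^-1 * (x m ^+ (weight nu - weight kap) *
     (schurc x m v * y ^+ (weight v - weight kap))))%:E).
  (* Here m <= n, so a shape with a nonzero last part has [schurc x m v] = 0; for the others the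
     hypothesis of [skew_cauchy1] holds. *)
  apply: eq_esum => v _; have [v0|vN0] := eqVneq (v ord_max) 0%N; last first.
    have -> : schurc x m v = 0.
      rewrite /schurc; case: supportedP; rewrite ?andbF // => /(_ ord_max) v0.
      by rewrite v0 // in vN0.
    by rewrite !esum1 // => ? _; rewrite ?mul0r !mulr0.
  transitivity ((schurc x m v)%:E * \esum_(l in [set l | interlace l v && interlace l
    nu])
      (x m ^+ (weight l - weight v) * y ^+ (weight l - weight nu))%:E)%E.
    rewrite -esumZl_ge0 ?schurc_ge0 //; last by move=> l; rewrite lee_fin e0.
    by apply: eq_esum => l _; rewrite -EFinM; congr EFin; lra.
  rewrite skew_cauchy1 // muleA -EFinM -esumZl_ge0 ?mulr_ge0 ?schurc_ge0 //; last first.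
    by move=> l; rewrite lee_fin e0.
  by apply: eq_esum => kap _; rewrite -EFinM; congr EFin; lra.
rewrite (exchange_esum (J' := [set kap | interlace nu kap])
   (I' := fun kap => [set v | interlace v kap])); last 2 first.
- by move=> l v _ _; rewrite lee_fin !mulr_ge0 ?exprn_ge0 ?schurc_ge0.
- by move=> l v; split => /= [[_ /andP[-> ->]]|[-> ->]].
have p0 : 0 <= \prod_(i < m) (1 - x i * y)^-1.
  by rewrite prodr_ge0 // => i _; rewrite invr_ge0 subr_ge0 ltW // xy1 // ltnW // ltnS.
rewrite big_ord_recr /= EFinM schurc_rec // -esumZl_ge0 ?mulr_ge0 //; last first.
  by move=> v; rewrite lee_fin mulr_ge0 ?exprn_ge0 ?schurc_ge0.
apply: eq_esum => kap _.
transitivity (((1 - x m * y)^-1 * x m ^+ (weight nu - weight kap))%:E *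
  \esum_(v in [set v | interlace v kap]) (schurc x m v * y ^+ (weight v - weight
    kap))%:E)%E.
  rewrite -esumZl_ge0 ?mulr_ge0 ?exprn_ge0 //; last first.
    by move=> v; rewrite lee_fin mulr_ge0 ?exprn_ge0 ?schurc_ge0.
  by apply: eq_esum => v _; rewrite -EFinM; congr EFin; lra.
rewrite IH //; last 2 first.
- by move=> i im; apply: xy1; rewrite ltnS ltnW.
- exact: ltnW.
by rewrite -!EFinM; congr EFin; lra.
Qed.

Lemma schurc_zero y m : (forall i, 0 <= y i) -> (m <= n.+1)%N ->
  schurc y m ([ffun=> 0%N] : {ffun 'I_n.+1 -> nat}) = 1.
Proof.
move=> y0; elim: m => [|m IH] mn; first by rewrite schurc0 eqxx.
apply: EFin_inj; rewrite schurc_rec //.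
rewrite (_ : [set v | _] = [set ([ffun=> 0%N] : {ffun 'I_n.+1 -> nat})]).
  by rewrite esum_set1 ?subnn ?mul1r ?IH ?(ltnW mn) ?lee_fin.
apply/seteqP; split => v /= => [/interlaceP[h _]|->].
  by apply: eq_natffun => i; have := h i; rewrite ffunE leqn0 => /eqP.
by apply/interlaceP; split=> i; rewrite !ffunE.
Qed.

(** Branching off [y m] turns the inner sum over l into a Pieri sum, so each y contributes its own
    product over the x. *)
Lemma schur_cauchy x y m :
  (forall i, 0 <= x i) -> (forall j, 0 <= y j) ->
  (forall i j, (i < n.+1)%N -> (j < m)%N -> x i * y j < 1) -> (m <= n.+1)%N ->
  \esum_(l in [set: {ffun 'I_n.+1 -> nat}]) (schurc x n.+1 l * schurc y m l)%:E =
  (\prod_(i < n.+1) \prod_(j < m) (1 - x i * y j)^-1)%:E.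
Proof.
move=> x0 y0; elim: m => [|m IH] xy1 mn.
  transitivity (\esum_(l in [set: {ffun 'I_n.+1 -> nat}])
      ((l == [ffun=> 0%N])%:R * schurc x n.+1 l)%:E).
    by apply: eq_esum => l _; rewrite schurc0 mulrC.
  rewrite esum_delta; last by move=> l; rewrite schurc_ge0.
  rewrite schurc_zero //; congr EFin; rewrite big1 // => i _.
  by rewrite big_ord0.
transitivity (\esum_(l in [set: {ffun 'I_n.+1 -> nat}]) \esum_(v in [set v |
  interlace l v])
   (schurc y m v * (schurc x n.+1 l * y m ^+ (weight l - weight v)))%:E).
  apply: eq_esum => l _; rewrite EFinM (schurc_rec _ y0) // -esumZl_ge0 ?schurc_ge0 //.
    by apply: eq_esum => v _; rewrite -EFinM; congr EFin; lra.
  by move=> v; rewrite lee_fin mulr_ge0 ?exprn_ge0 ?schurc_ge0.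
rewrite (exchange_esum (J' := setT) (I' := fun v => [set l | interlace l v]));
  last 2 first.
- by move=> l v _ _; rewrite lee_fin !mulr_ge0 ?exprn_ge0 ?schurc_ge0.
- by move=> l v; split => -[].
have c0 : 0 <= \prod_(i < n.+1) (1 - x i * y m)^-1.
  by rewrite prodr_ge0 // => i _; rewrite invr_ge0 subr_ge0 ltW // xy1.
transitivity (\esum_(v in [set: {ffun 'I_n.+1 -> nat}])
   ((\prod_(i < n.+1) (1 - x i * y m)^-1)%:E * (schurc x n.+1 v * schurc y m v)%:E)%E).
  apply: eq_esum => v _.
  transitivity ((schurc y m v)%:E * \esum_(l in [set l | interlace l v])
      (schurc x n.+1 l * y m ^+ (weight l - weight v))%:E)%E.
    rewrite -esumZl_ge0 ?schurc_ge0 //.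
    by move=> l; rewrite lee_fin !mulr_ge0 ?exprn_ge0 ?schurc_ge0.
  rewrite pieri // => [|i im]; last exact: xy1.
  by rewrite -!EFinM; congr EFin; lra.
rewrite esumZl_ge0 //; last by move=> v; rewrite lee_fin mulr_ge0 ?schurc_ge0.
rewrite IH //; last 2 first.
- by move=> i j iN jm; apply: xy1; rewrite // ltnS ltnW.
- exact: ltnW.
rewrite -EFinM; congr EFin; rewrite -big_split; apply: eq_bigr => i _ /=.
by rewrite big_ord_recr /= mulrC.
Qed.

End Cauchy.

(** * Bialternant formula *)

Section Determinants.
Context {R : realType}.

Lemma det_sum_cols N (T : finType) (Q : 'I_N -> pred T)
    (F : 'I_N -> 'I_N -> T -> R) :
  \det (\matrix_(i, j) \sum_(t | Q j t) F i j t) =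
  \sum_(f : {ffun 'I_N -> T} | [forall j, Q j (f j)])
    \det (\matrix_(i, j) F i j (f j)).
Proof.
rewrite -det_tr.
transitivity (\sum_(s : 'S_N) \sum_(f in family Q)
    (-1) ^+ s * \prod_j F (s j) j (f j)).
  apply: eq_bigr => s _; rewrite -big_distrr /=; congr (_ * _).
  by rewrite -(@bigA_distr_big_dep _ _ _ _ _ _ _ _ (fun j t => F (s j) j t));
    apply: eq_bigr => j _; rewrite !mxE.
rewrite exchange_big /=; apply: eq_big => [f|f _]; first exact/familyP/forallP.
rewrite -[RHS]det_tr; apply: eq_bigr => s _.
by congr (_ * _); apply: eq_bigr => j _; rewrite !mxE.
Qed.

Lemma det_scale_rows_cols N (r c : 'I_N -> R) (M : 'I_N -> 'I_N -> R) :
  \det (\matrix_(i, j) (r i * c j * M i j)) =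
  (\prod_i r i) * (\prod_j c j) * \det (\matrix_(i, j) M i j).
Proof.
rewrite [RHS]big_distrr; apply: eq_bigr => s _ /=.
rewrite [RHS]mulrCA; congr (_ * _).
have -> : \prod_j c j = \prod_j c (s j) by rewrite (reindex_perm s).
rewrite -!big_split /=.
by apply: eq_bigr => i _; rewrite !mxE.
Qed.

(** A telescoping sum. The window from p to q will be the range of one part of an interlacing
    partition, which links column differences to the branching rule. *)
Lemma sum_geometric_window (x z : R) (e p q M : nat) : (p <= q < M)%N ->
  (x - z) * \sum_(t < M | (p <= t <= q)%N) (x ^+ (t + e) * z ^+ (q - t)) =
  x ^+ (q + e).+1 - z ^+ (q - p).+1 * x ^+ (p + e).
Proof.
case/andP => pq qM.
rewrite (_ : \sum_(t < M | _) _ = \sum_(p <= t < q.+1) x ^+ (t + e) * z ^+ (q - t));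
  last first.
  rewrite -(big_mkord (fun t => (p <= t <= q)%N) (fun t =>
    x ^+ (t + e) * z ^+ (q - t))).
  by rewrite [RHS](big_nat_widenl _ 0) // [RHS](big_nat_widen _ _ M) //;
    apply: eq_bigl => t.
move: pq => /subnKC <-; move: (q - p)%N => d {q qM}; rewrite addKn.
elim: d => [|d IH].
  by rewrite addn0 big_nat1 subnn expr0 mulr1 expr1 mulrBl -exprS.
rewrite big_nat_recr ?leq_addr //= addnS subnn expr0 mulr1 mulrDr.
rewrite (_ : \sum_(_ <= _ < _) _ = z * \sum_(p <= t < (p + d).+1) x ^+ (t + e) * z ^+
  (p + d - t)).
  rewrite mulrCA IH addSn !exprS. lra.
rewrite big_distrr /= !big_nat; apply: eq_bigr => t /andP[_ tq].
by rewrite subSn // exprS mulrCA.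
Qed.

End Determinants.

Section Bialternant.
Context {R : realType}.

(** Induction on the number of variables. Column operations clear the last row except for its last
    entry; each entry of the remaining minor is [y i - y m] times a geometric window, and expanding
    its columns reproduces the branching rule that removes [y m]. *)
Lemma bialternant (y : nat -> R) m (l : {ffun 'I_m -> nat}) :
  is_part l ->
  \det (\matrix_(i < m, j < m) y i ^+ (l j + (m.-1 - j))) =
  (\prod_(i < m) \prod_(j < m | (i < j)%N) (y i - y j)) * tableau_sum y l.
Proof.
elim: m l => [|m IH] l lP; first by rewrite det_mx00 big_ord0 mul1r.
pose a (j : 'I_m.+1) := (l j + (m - j))%N.
pose A := \matrix_(i < m.+1, j < m.+1) y i ^+ a j.
pose U := \matrix_(k < m.+1, j < m.+1)
  (if k == j then 1 else if k == j.+1 :> nat then - y m ^+ (a j - a k) else 0).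
(* Right multiplication by U replaces column j < m by
   col_j - y_m^(a_j - a_(j+1)) col_(j+1), which vanishes in the last row. *)
have detU : \det U = 1.
  rewrite det_trig; first by rewrite big1 // => i _; rewrite mxE eqxx.
  apply/is_trig_mxP => i j ij; rewrite mxE -val_eqE /= (ltn_eqF ij).
  by rewrite (ltn_eqF (leq_trans ij (leqnSn j))).
have -> : \det (\matrix_(i < m.+1, j < m.+1) y i ^+ (l j + (m.+1.-1 - j))) = \det (A
  *m U).
  by rewrite det_mulmx detU mulr1.
have aS (j : 'I_m) : (a (lift ord0 j) < a (lift ord_max j))%N.
  rewrite /a lift0 lift_max; have := is_partP _ lP j; have := ltn_ord j; lia.
have AUl i (j : 'I_m) : (A *m U) i (lift ord_max j) =
    y i ^+ a (lift ord_max j)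
    - y m ^+ (a (lift ord_max j) - a (lift ord0 j)) * y i ^+ a (lift ord0 j).
  have n0m : lift ord0 j != lift ord_max j.
    by apply/eqP => /(congr1 (@nat_of_ord _)); rewrite lift0 lift_max; lia.
  rewrite mxE (bigD1 (lift ord_max j)) //= (bigD1 (lift ord0 j)) //= big1 =>
    [|k /andP[kN k0]].
    rewrite !mxE eqxx (negbTE n0m) lift0 lift_max eqxx mulr1 addr0 mulrN.
    by rewrite [X in _ - X]mulrC.
  rewrite !mxE (negbTE kN) ifN ?mulr0 //; apply: contraNneq k0 => kE.
  by apply/eqP/ord_inj; rewrite lift0 kE lift_max.
have AUm i : (A *m U) i ord_max = y i ^+ l ord_max.
  rewrite mxE (bigD1 ord_max) //= big1 => [|k kN].
    by rewrite !mxE eqxx mulr1 addr0 /a /= subnn addn0.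
  by rewrite !mxE (negbTE kN) ifN ?mulr0 // ltn_eqF.
rewrite (expand_det_row _ ord_max) (bigD1 ord_max) //= big1 => [|j jN]; last first.
  case: (ord_caseS_max j) jN => [[k ->]|->] //; last by rewrite eqxx.
  by rewrite AUl -exprD subnK ?subrr ?mul0r // ltnW.
rewrite addr0 AUm /cofactor -signr_odd addnn odd_double expr0 mul1r.
have entry (i j : 'I_m) : y i ^+ a (lift ord_max j)
    - y m ^+ (a (lift ord_max j) - a (lift ord0 j)) * y i ^+ a (lift ord0 j) =
    \sum_(t < (l ord0).+1 | (l (lift ord0 j) <= t <= l (lift ord_max j))%N)
      ((y i - y m) * y m ^+ (l (lift ord_max j) - t) * y i ^+ (t + (m.-1 - j))).
  have l0 : (l (lift ord_max j) < (l ord0).+1)%N.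
    by rewrite ltnS; have /forallP/(_ (lift ord_max j))/implyP := forallP lP ord0;
      apply.
  have jm := ltn_ord j.
  have := sum_geometric_window (y i) (y m) (m.-1 - j) (introT andP (conj (is_partP _
    lP j) l0)).
  rewrite (_ : (l (lift ord_max j) + (m.-1 - j)).+1 = a (lift ord_max j));
    last by rewrite /a lift_max; lia.
  rewrite (_ : (l (lift ord0 j) + (m.-1 - j))%N = a (lift ord0 j));
    last by rewrite /a lift0; lia.
  rewrite (_ : (l (lift ord_max j) - l (lift ord0 j)).+1 = (a (lift ord_max j) - a
    (lift ord0 j))%N); last first.
    by rewrite /a lift0 lift_max; have := is_partP _ lP j; lia.
  by move=> <-; rewrite big_distrr; apply: eq_bigr => t _ /=; lra.
have -> : row' ord_max (col' ord_max (A *m U)) = \matrix_(i < m, j < m)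
    \sum_(t < (l ord0).+1 | (l (lift ord0 j) <= t <= l (lift ord_max j))%N)
      ((y i - y m) * y m ^+ (l (lift ord_max j) - t) * y i ^+ (t + (m.-1 - j))).
  by apply/matrixP => i j; rewrite [RHS]mxE [LHS]mxE [LHS]mxE AUl lift_max -entry.
rewrite (det_sum_cols (fun (j : 'I_m) (t : 'I_(l ord0).+1) =>
  l (lift ord0 j) <= t <= l (lift ord_max j))%N
  (fun i j t => (y i - y m) * y m ^+ (l (lift ord_max j) - t) * y i ^+ (t + (m.-1 -
    j)))).
rewrite /= mulrC big_distrl big_distrr /=.
apply: eq_bigr => f /forallP fP.
rewrite (det_scale_rows_cols (fun i => y i - y m)
  (fun j => y m ^+ (l (lift ord_max j) - f j)) (fun i j => y i ^+ (f j + (m.-1 - j)))).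
(* For i < j, f_i >= l_(i+1) >= l_j >= f_j: successive windows are ordered, so every term of the
   expansion is a partition and the induction hypothesis applies to it. *)
have fpart : is_part [ffun j => f j : nat].
  apply/forallP => i; apply/forallP => j; apply/implyP => ij; rewrite !ffunE.
  move: ij; rewrite leq_eqVlt => /orP[/eqP/ord_inj -> //|ij].
  have /andP[_ fj] := fP j; have /andP[fi _] := fP i.
  apply: leq_trans fj (leq_trans _ fi).
  have /forallP/(_ (lift ord_max j))/implyP := forallP lP (lift ord0 i); apply.
  by rewrite lift0 lift_max.
have := IH _ fpart; rewrite (_ : \matrix_(i, j) _ =
  \matrix_(i, j) y i ^+ (f j + (m.-1 - j))) => [->|]; last first.
  by apply/matrixP => i j; rewrite !mxE ffunE.
have -> : \prod_(i < m.+1) \prod_(j < m.+1 | (i < j)%N) (y i - y j) =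
    (\prod_(i < m) \prod_(j < m | (i < j)%N) (y i - y j)) * \prod_(i < m) (y i - y m).
  rewrite big_ord_recr /= [X in _ * X]big_pred0 ?mulr1 => [|j];
    last by rewrite ltnNge -ltnS ltn_ord.
  rewrite -big_split; apply: eq_bigr => i _ /=.
  rewrite big_mkcond big_ord_recr /= ltn_ord; congr (_ * _).
  by rewrite [RHS]big_mkcond.
have -> : y m ^+ (weight l - \sum_(j < m) f j) =
    (\prod_(j < m) y m ^+ (l (lift ord_max j) - f j)) * y m ^+ l ord_max.
  rewrite prodrXr -exprD; congr (_ ^+ _); rewrite sumnB => [|j _];
    last by have /andP[] := fP j.
  rewrite /weight sum_lift_max -addnBAC // leq_sum // => j _.
  by have /andP[] := fP j.
lra.
Qed.

End Bialternant.

(** * Extension by continuity *)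

Section GenericPoints.
Context {R : realType}.

Lemma dnbhs_neq (a c : R) : \forall t \near a^', t != c.
Proof.
have [->|ca] := eqVneq c a; first exact: nbhs_dnbhs_neq.
apply: nbhs_dnbhs; have := @cvgr_neq0 _ _ _ (nbhs a) _ (fun t => t - c) (a - c).
rewrite subr_eq0 eq_sym ca => h; near=> t; rewrite -subr_eq0; near: t.
by apply: h => //; apply: cvgB; [exact: cvg_id|exact: cvg_cst].
Unshelve. all: by end_near. Qed.

(** The line x + t (1, 2, ..., N) has distinct slopes, all nonzero, so each coincidence or zero of
    coordinates occurs for at most one t; small t different from 0 are generic. *)
Lemma generic_dense N (x : 'rV[R]_N) : closure (@generic R N) x.
Proof.
move=> B [P xP PB]; pose z (t : R) : 'rV[R]_N := \row_i (x ord0 i + t * i.+1%:R).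
suff [t [gt Pt]] : exists t, @generic R N (z t) /\ forall i j, P i j (z t i j).
  by exists (z t); split=> //; exact: PB.
have nz (i : 'I_N) : \forall t \near (0 : R)^', x ord0 i + t * i.+1%:R != 0.
  have := dnbhs_neq 0 (- x ord0 i / i.+1%:R); apply: filterS => t; apply: contraNN.
  by rewrite addrC addr_eq0 => /eqP <-; rewrite mulfK ?pnatr_eq0 ?eqxx.
have inj (i j : 'I_N) : \forall t \near (0 : R)^', z t ord0 i = z t ord0 j -> i = j.
  have [->|ij] := eqVneq i j; first exact: nearW.
  have ij0 : i.+1%:R - j.+1%:R != 0 :> R by rewrite subr_eq0 eqr_nat eqSS.
  have := dnbhs_neq 0 ((x ord0 j - x ord0 i) / (i.+1%:R - j.+1%:R)).
  apply: filterS => t /eqP tN e; case: tN.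
  by rewrite -[LHS](mulfK ij0); congr (_ / _); move: e; rewrite !mxE; lra.
have nbh (i : 'I_1) (j : 'I_N) : \forall t \near (0 : R)^', P i j (z t i j).
  have c : continuous (fun t : R => x ord0 j + t * j.+1%:R).
    move=> t; apply: (@continuousD R R R (fun=> x ord0 j) (fun t => t * j.+1%:R) t);
      first exact: cst_continuous.
    by apply: (@continuousM R R id (fun=> j.+1%:R) t);
      [exact: cvg_id|exact: cst_continuous].
  have h : nbhs (0 : R) [set t | P ord0 j (x ord0 j + t * j.+1%:R)].
    by apply: (c 0 (P ord0 j)); rewrite /= mul0r addr0; exact: xP.
  by apply: nbhs_dnbhs; apply: filterS h => t; rewrite mxE (ord1 i).
have PF : ProperFilter (0 : R)^' := Proper_dnbhs_numFieldType 0.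
have FF := @filter_filter _ _ PF.
have nzA := filter_forall FF nz.
have injA := filter_forall FF (fun i => filter_forall FF (inj i)).
have nbhA := filter_forall FF (fun i => filter_forall FF (nbh i)).
have [t [[t1 t2] t3]] := filter_ex (filterI (filterI nzA injA) nbhA).
exists t; split=> //; split => [i j /t2//|i]; by rewrite mxE.
Qed.

(** Density makes the restricted filter proper, so the limit defining [alternant] is unique and
    equals the value of any continuous extension. *)
Lemma alternant_eq N (f : 'I_N -> R -> R) (P : 'rV[R]_N -> R) (x : 'rV[R]_N) :
  continuous P -> (forall z, generic z -> alternant_ratio f z = P z) ->
  alternant f x = P x.
Proof.
move=> Pc fP; have xp := within_nbhs_proper (@generic_dense _ x).
have PW : P z @[z --> within (@generic R N) (nbhs x)] --> P x.
  by apply: cvg_within_filter; exact: Pc.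
apply: cvg_lim => //; apply: cvg_trans PW.
by apply: near_eq_cvg; rewrite near_withinE; apply: nearW => z /fP.
Qed.

Lemma generic_continuous_eq N (P Q : 'rV[R]_N -> R) (x : 'rV[R]_N) :
  continuous P -> continuous Q -> (forall z, generic z -> P z = Q z) -> P x = Q x.
Proof.
move=> Pc Qc PQ; have xp := within_nbhs_proper (@generic_dense _ x).
have PW : P z @[z --> within (@generic R N) (nbhs x)] --> P x.
  by apply: cvg_within_filter; exact: Pc.
have QW : Q z @[z --> within (@generic R N) (nbhs x)] --> Q x.
  by apply: cvg_within_filter; exact: Qc.
apply: (cvg_unique _ PW) => //; apply: cvg_trans QW.
by apply: near_eq_cvg; rewrite near_withinE; apply: nearW => z /PQ.
Qed.

(** An index beyond n falls back on a coordinate of x, so signs and continuity hold for every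
    natural number. *)
Definition vars n (x : 'rV[R]_n.+1) (i : nat) : R := x ord0 (inord i).

Section ContinuousSums.
Context {T : topologicalType}.

Lemma continuous_sum (I : Type) (r : seq I) (P : pred I) (F : I -> T -> R) :
  (forall i, continuous (F i)) -> continuous (fun z => \sum_(i <- r | P i) F i z).
Proof. by move=> Fc; apply: continuous_big => //; exact: add_continuous. Qed.

Lemma continuous_prod (I : Type) (r : seq I) (P : pred I) (F : I -> T -> R) :
  (forall i, continuous (F i)) -> continuous (fun z => \prod_(i <- r | P i) F i z).
Proof. by move=> Fc; apply: continuous_big => //; exact: mul_continuous. Qed.

Lemma continuous_mul (f g : T -> R) : continuous f -> continuous g -> continuous (fun
  z => f z * g z).
Proof. by move=> fc gc z; apply: continuousM; [exact: fc|exact: gc]. Qed.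

Lemma continuous_exp (f : T -> R) k : continuous f -> continuous (fun z => f z ^+ k).
Proof. by move=> fc z; apply: (@continuous_comp T R R f (fun t => t ^+ k) z);
  [exact: fc|exact: exprn_continuous]. Qed.

End ContinuousSums.

Lemma vars_continuous n i : continuous (fun x : 'rV[R]_n.+1 => vars x i).
Proof. exact: coord_continuous. Qed.

Lemma tableau_sum_continuous n m (l : {ffun 'I_m -> nat}) :
  continuous (fun x : 'rV[R]_n.+1 => tableau_sum (vars x) l).
Proof.
elim: m l => [|m IH] l /=; first exact: cst_continuous.
apply: continuous_sum => f; apply: continuous_mul; last exact: IH.
by apply: continuous_exp; exact: vars_continuous.
Qed.

End GenericPoints.

(** * Expansion of one linear factor *)

Section Ratios.
Context {R : realType}.
Variable n : nat.
Implicit Types (l : {ffun 'I_n.+1 -> nat}) (e : {ffun 'I_n.+1 -> bool}).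

Definition add_strip l e : {ffun 'I_n.+1 -> nat} := [ffun j => l j + e j]%N.
Definition sub_strip l e : {ffun 'I_n.+1 -> nat} := [ffun j => l j - e j]%N.
Lemma add_stripE l e (j : 'I_n.+1) : add_strip l e j = (l j + e j)%N. Proof. by
  rewrite ffunE. Qed.

Lemma sub_stripE l e (j : 'I_n.+1) : sub_strip l e j = (l j - e j)%N. Proof. by
  rewrite ffunE. Qed.

Definition countb e : nat := (\sum_j e j)%N.

Lemma eq_alternant_ratio N (f g : 'I_N -> R -> R) (z : 'rV[R]_N) :
  (forall j i, f j (z ord0 i) = g j (z ord0 i)) ->
  alternant_ratio f z = alternant_ratio g z.
Proof.
move=> fg; congr (\det _ / _); apply/matrixP => i j; rewrite !mxE; exact: fg.
Qed.

Lemma alternant_ratio_collision N (f : 'I_N -> R -> R) (z : 'rV[R]_N) (j k : 'I_N) :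
  j != k -> (forall i, f j (z ord0 i) = f k (z ord0 i)) -> alternant_ratio f z = 0.
Proof.
move=> jk fjk; rewrite /alternant_ratio -det_tr (determinant_alternate jk) ?mul0r //
  => i.
by rewrite !mxE.
Qed.

Lemma alternant_ratio_binomial N (S : pred 'I_N) (b : R) (F G : 'I_N -> R -> R)
    (z : 'rV[R]_N) :
  alternant_ratio (fun j t => F j t + (if S j then b * G j t else 0)) z =
  \sum_(e : {ffun 'I_N -> bool} | [forall j, e j ==> S j])
    b ^+ (\sum_j e j)%N * alternant_ratio (fun j t => if e j then G j t else F j t) z.
Proof.
rewrite /alternant_ratio.
(* Each entry is a sum over a boolean, true selecting [b * G] in the columns of S. The leading 1 is
   the row factor expected by [det_scale_rows_cols]. *)
rewrite (_ : \matrix_(i, j) _ = \matrix_(i, j) \sum_(t : bool | t ==> S j)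
  (1 * b ^+ t * (if t then G j (z ord0 i) else F j (z ord0 i)))); last first.
  apply/matrixP => i j; rewrite !mxE big_mkcond big_bool /= addrC !mul1r.
  by case: (S j); rewrite /= ?expr1.
rewrite (det_sum_cols (fun j t => t ==> S j)
  (fun i j t => 1 * b ^+ (nat_of_bool t) * (if t then G j (z ord0 i) else F j (z ord0
    i)))).
rewrite big_distrl /=; apply: eq_bigr => e _.
rewrite (det_scale_rows_cols (fun=> 1) (fun j => b ^+ e j)) prodrXr mulrA.
by rewrite big1 // mul1r.
Qed.

Lemma alternant_ratio_schur (z : 'rV[R]_n.+1) l : generic z -> is_part l ->
  alternant_ratio (fun j t => t ^+ (l j + (n - j))) z = tableau_sum (vars z) l.
Proof.
move=> [zi z0] lP; rewrite /alternant_ratio.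
rewrite (_ : \matrix_(i, j) _ = \matrix_(i < n.+1, j < n.+1) vars z i ^+ (l j +
  (n.+1.-1 - j))); last first.
  by apply/matrixP => i j; rewrite !mxE /vars inord_val.
have -> : \prod_(i < n.+1) \prod_(j < n.+1 | (i < j)%N) (z ord0 i - z ord0 j) =
    \prod_(i < n.+1) \prod_(j < n.+1 | (i < j)%N) (vars z i - vars z j).
  by apply: eq_bigr => i _; apply: eq_bigr => j _; rewrite /vars !inord_val.
rewrite bialternant // mulrAC mulfV ?mul1r //.
apply/prodf_neq0 => i _; apply/prodf_neq0 => j ij.
rewrite /vars !inord_val subr_eq0; apply: contraTneq ij => /zi ->.
by rewrite ltnn.
Qed.

(** [e] marks the columns that contribute -b t, which raises their part by one. If l + e is not a
    partition, then l_j = l_(j+1) for some j with only column j+1 raised; columns j and j+1 then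
    have equal powers, and equal factors c since j+1 lies in S. *)
Lemma alternant_ratio_up (c : 'I_n.+1 -> R -> R) (S : pred 'I_n.+1) (b : R)
    (z : 'rV[R]_n.+1) l : is_part l ->
  (forall j : 'I_n, S (lift ord0 j) -> c (lift ord0 j) =1 c (lift ord_max j)) ->
  alternant_ratio (fun j t => t ^+ (l j + (n - j)) * (c j t * (if S j then 1 - b * t
    else 1))) z =
  \sum_(e : {ffun 'I_n.+1 -> bool} | [forall j, e j ==> S j] && is_part (add_strip l e))
    (- b) ^+ countb e * alternant_ratio (fun j t =>
      t ^+ (add_strip l e j + (n - j)) * c j t) z.
Proof.
move=> lP cS.
rewrite (@eq_alternant_ratio _ _ (fun j t => t ^+ (l j + (n - j)) * c j t +
    (if S j then - b * (t ^+ (l j + (n - j)).+1 * c j t) else 0))); last first.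
  by move=> j i; case: (S j); rewrite ?exprS; lra.
rewrite alternant_ratio_binomial [RHS]big_mkcondr; apply: eq_bigr => e /forallP eS.
rewrite (@eq_alternant_ratio _ _ (fun j t =>
  t ^+ (add_strip l e j + (n - j)) * c j t)); last first.
  by move=> j i; rewrite ffunE; case: (e j); rewrite ?addn0 // addn1 addSn.
case: is_partP => // leN; rewrite [X in _ * X](_ : _ = 0) ?mulr0 //.
have /existsP[j] : [exists j : 'I_n, ~~ (add_strip l e (lift ord0 j) <= add_strip l e
  (lift ord_max j))%N].
  by rewrite -negb_forall; apply: contra_notN leN => /forallP.
rewrite !ffunE => ej.
have [[e0 em] ll] : (e (lift ord0 j) = true /\ e (lift ord_max j) = false) /\
   l (lift ord0 j) = l (lift ord_max j).
  have := is_partP _ lP j; move: ej.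
  by case: (e (lift ord0 j)); case: (e (lift ord_max j)) => /=; lia.
have jn := ltn_ord j.
apply: (@alternant_ratio_collision _ _ _ (lift ord0 j) (lift ord_max j)).
  by apply/eqP => /(congr1 (@nat_of_ord _)); rewrite lift0 lift_max; lia.
move=> i; rewrite cS; last by have := eS (lift ord0 j); rewrite e0.
rewrite !ffunE e0 em ll lift0 lift_max; congr (_ ^+ _ * _) => /=; lia.
Qed.

(** The first condition excludes truncation in [sub_strip]. *)
Definition down_ok l e : bool := [forall j, (e j <= l j)%N] && is_part (sub_strip l e).

(** The last column is kept out of S because its power t^(l_n) may be constant; every other column
    has a positive power, so dividing by t leaves a polynomial. Outside [down_ok] two neighbouring
    exponents coincide. *)
Lemma alternant_ratio_down (c : 'I_n.+1 -> R -> R) (S : pred 'I_n.+1) (b : R)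
    (z : 'rV[R]_n.+1) l : is_part l -> (forall i, z ord0 i != 0) -> ~~ S ord_max ->
  (forall j : 'I_n, S (lift ord_max j) -> c (lift ord0 j) =1 c (lift ord_max j)) ->
  alternant_ratio (fun j t => t ^+ (l j + (n - j)) * (c j t * (if S j then 1 - b *
    t^-1 else 1))) z =
  \sum_(e : {ffun 'I_n.+1 -> bool} | [forall j, e j ==> S j] && down_ok l e)
    (- b) ^+ countb e * alternant_ratio (fun j t =>
      t ^+ (sub_strip l e j + (n - j)) * c j t) z.
Proof.
move=> lP z0 Smax cS.
have Sn (j : 'I_n.+1) : S j -> (j < n)%N.
  move=> Sj; rewrite ltn_neqAle -ltnS ltn_ord andbT; apply: contraNneq Smax => jn.
  by rewrite (_ : ord_max = j) //; apply: ord_inj.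
rewrite (@eq_alternant_ratio _ _ (fun j t => t ^+ (l j + (n - j)) * c j t +
    (if S j then - b * (t ^+ (l j + (n - j)).-1 * c j t) else 0))); last first.
  move=> j i; case: ifPn => [/Sn jn|_]; last by lra.
  have -> : (l j + (n - j) = (l j + (n - j)).-1.+1)%N by lia.
  rewrite /= exprS; set w := z ord0 i; set p := w ^+ _;
    have w1 : w * w^-1 = 1 by rewrite mulfV ?z0.
  by transitivity (w * p * c j w - b * (w * w^-1) * (p * c j w)); [lra|rewrite w1; lra].
rewrite alternant_ratio_binomial [RHS]big_mkcondr; apply: eq_bigr => e /forallP eS.
pose E (j : 'I_n.+1) : nat := (l j + (n - j) - e j)%N.
rewrite (@eq_alternant_ratio _ _ (fun j t => t ^+ E j * c j t)); last first.
  by move=> j i; rewrite /E; case: (e j); rewrite ?subn0 // subn1.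
have e_max : e ord_max = false.
  by apply/negbTE; apply: contra Smax => em; have := eS ord_max; rewrite em.
(* The original exponents decrease strictly, so lowering some by one leaves them weakly
   decreasing. *)
have Elt (j : 'I_n) : E (lift ord0 j) != E (lift ord_max j) -> (E (lift ord0 j) < E
  (lift ord_max j))%N.
  rewrite /E lift0 lift_max => EN; have := is_partP _ lP j; have := ltn_ord j; move: EN.
  by case: (e (lift ord0 j)); case: (e (lift ord_max j)) => /=; lia.
case: ifPn => [/andP[/forallP el0 _]|okN].
  have el (j : 'I_n.+1) : (e j <= l j)%N := el0 j.
  congr (_ * _); apply: eq_alternant_ratio => j i; congr (_ ^+ _ * _).
  by rewrite /E sub_stripE addnBAC.
rewrite [X in _ * X](_ : _ = 0) ?mulr0 //.
have /existsP[j /eqP Ej] : [exists j : 'I_n, E (lift ord0 j) == E (lift ord_max j)].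
  apply: contraNT okN; rewrite negb_exists => /forallP EN.
  (* Induction from the last column, where e is 0: a lowered part l_j = 0 would need E_(j+1) < n - j
     - 1, that is e_(j+1) > l_(j+1). *)
  have el (i : 'I_n.+1) : (e i <= l i)%N.
    move: {2}(n - i)%N (erefl (n - i)%N) => k; elim: k i => [|k IH] i ik.
      rewrite (_ : i = ord_max) ?e_max //; apply: ord_inj => /=; have := ltn_ord i; lia.
    case: (ord_caseS_max i) ik => [[j ->]|->]; last by rewrite e_max.
    rewrite lift_max => jk; have := Elt j (EN j); have := IH (lift ord0 j).
    rewrite /E lift0 lift_max => /(_ ltac:(lia)).
    by case: (e (lift ord_max j)) => //=; lia.
  apply/andP; split; first exact/forallP.
  apply/is_partP => j; have := Elt j (EN j); have := el (lift ord0 j);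
    have := el (lift ord_max j).
  rewrite !sub_stripE /E lift0 lift_max; have := ltn_ord j.
  by case: (e (lift ord0 j)); case: (e (lift ord_max j)) => /=; lia.
have jn := ltn_ord j.
apply: (@alternant_ratio_collision _ _ _ (lift ord0 j) (lift ord_max j)).
  by apply/eqP => /(congr1 (@nat_of_ord _)); rewrite lift0 lift_max; lia.
move=> i; rewrite cS ?Ej //.
(* A collision forces column j itself to be lowered, so j lies in S and the factors c of the two
   columns agree. *)
have := eS (lift ord_max j); case em: (e (lift ord_max j)) => //= _.
have := is_partP _ lP j; move: Ej; rewrite /E lift0 lift_max em; lia.
Qed.

End Ratios.

#[local] Arguments tableau_sum : simpl never.

(** * Grothendieck polynomials as iterated strip sums *)

Section StepSums.
Context {R : realType}.
Variable n : nat.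
Variable b : nat -> R.
Implicit Types (l : {ffun 'I_n.+1 -> nat}) (x : nat -> R).

(* [up_sum x k l] sums over the entries mu^i_j with i < j, in the rows i < k,
   of the arrays whose row k is [l]; [down_sum x k l] sums over the entries with
   j < i in the last k rows, the row n - k being [l]. *)
Fixpoint up_sum x k l : R :=
  if k is k'.+1 then
    \sum_(e : {ffun 'I_n.+1 -> bool} |
          [forall j, e j ==> (k' < j)%N] && is_part (add_strip l e))
      (- b k') ^+ countb e * up_sum x k' (add_strip l e)
  else tableau_sum x l.

Fixpoint down_sum x k l : R :=
  if k is k'.+1 then
    \sum_(e : {ffun 'I_n.+1 -> bool} |
          [forall j, e j ==> (j <= n - k'.+1)%N] && down_ok l e)
      (- b (n - k'.+1)) ^+ countb e * down_sum x k' (sub_strip l e)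
  else tableau_sum x l.

Lemma up_sum_ge0 x k l : (forall r, b r <= 0) -> (forall i, 0 <= x i) ->
  0 <= up_sum x k l.
Proof.
move=> b0 x0; elim: k l => [|k IH] l /=; first exact: tableau_sum_ge0.
by apply: sumr_ge0 => e _; rewrite mulr_ge0 // exprn_ge0 // oppr_ge0.
Qed.

Lemma down_sum_ge0 x k l : (forall r, b r <= 0) -> (forall i, 0 <= x i) ->
  0 <= down_sum x k l.
Proof.
move=> b0 x0; elim: k l => [|k IH] l /=; first exact: tableau_sum_ge0.
by apply: sumr_ge0 => e _; rewrite mulr_ge0 // exprn_ge0 // oppr_ge0.
Qed.

Lemma up_sum_continuous k l :
  continuous (fun z : 'rV[R]_n.+1 => up_sum (vars z) k l).
Proof.
elim: k l => [|k IH] l /=; first exact: tableau_sum_continuous.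
by apply: continuous_sum => e; apply: continuous_mul; [exact: cst_continuous|exact: IH].
Qed.

Lemma down_sum_continuous k l :
  continuous (fun z : 'rV[R]_n.+1 => down_sum (vars z) k l).
Proof.
elim: k l => [|k IH] l /=; first exact: tableau_sum_continuous.
by apply: continuous_sum => e; apply: continuous_mul; [exact: cst_continuous|exact: IH].
Qed.

(** Removing the factor of largest index k leaves the same product, over r < k, in all columns j >=
    k, as [alternant_ratio_up] requires. *)
Lemma alternant_ratio_up_sum (z : 'rV[R]_n.+1) k l : generic z -> is_part l ->
  (k <= n)%N ->
  alternant_ratio (fun j t => t ^+ (l j + (n - j)) *
                     \prod_(r < minn j k) (1 - b r * t)) z =
  up_sum (vars z) k l.
Proof.
move=> gz; elim: k l => [|k IH] l lP kn /=.
  rewrite -alternant_ratio_schur //; apply: eq_alternant_ratio => j i.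
  by rewrite minn0 big_ord0 mulr1.
rewrite (@eq_alternant_ratio _ _ _ (fun j t => t ^+ (l j + (n - j)) *
    ((\prod_(r < minn j k) (1 - b r * t)) * (if (k < j)%N then 1 - b k * t else
      1)))); last first.
  move=> j i; congr (_ * _); case: ltnP => kj.
    by rewrite (_ : minn j k.+1 = k.+1) ?(_ : minn j k = k) ?big_ord_recr //=; lia.
  by rewrite (minn_idPl (leqW kj)) ?(minn_idPl kj) mulr1.
rewrite alternant_ratio_up //; last first.
  move=> j; rewrite lift0 ltnS => kj t; cbv beta.
  by rewrite ?lift0 ?lift_max !(minn_idPr _) // leqW.
by apply: eq_bigr => e /andP[_ eP]; rewrite IH // ltnW.
Qed.

(** Here the factor of smallest index goes first: with r = n - k - 1 removed, all columns j <= n - k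
    share the product over n - k <= r < n. *)
Lemma alternant_ratio_down_sum (z : 'rV[R]_n.+1) k l : generic z -> is_part l ->
  (k <= n)%N ->
  alternant_ratio (fun j t => t ^+ (l j + (n - j)) *
                     \prod_(maxn j (n - k) <= r < n) (1 - b r * t^-1)) z =
  down_sum (vars z) k l.
Proof.
move=> gz; elim: k l => [|k IH] l lP kn /=.
  rewrite -alternant_ratio_schur //; apply: eq_alternant_ratio => j i.
  by rewrite big_geq ?mulr1 // subn0 leq_maxr.
rewrite (@eq_alternant_ratio _ _ _ (fun j t => t ^+ (l j + (n - j)) *
    ((\prod_(maxn j (n - k) <= r < n) (1 - b r * t^-1)) *
     (if (j <= n - k.+1)%N then 1 - b (n - k.+1)%N * t^-1 else 1)))); last first.
  move=> j i; congr (_ * _); case: leqP => kj.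
    have nk : (n - k = (n - k.+1).+1)%N by lia.
    have jk : (j <= n - k)%N by rewrite nk leqW.
    have nkn : (n - k.+1 < n)%N by rewrite -nk leq_subr.
    by rewrite (maxn_idPr jk) [LHS]big_ltn // -nk mulrC.
  have jk : (n - k <= j)%N by rewrite (leq_trans _ kj) // -subSn.
  by rewrite (maxn_idPl jk) mulr1.
rewrite (alternant_ratio_down (S := fun j : 'I_n.+1 => (j <= n - k.+1)%N)) //.
- by apply: eq_bigr => e /andP[_ /andP[_ eP]]; rewrite IH // ltnW.
- by case: gz.
- by rewrite -ltnNge /=; lia.
- move=> j; rewrite lift_max => kj t; cbv beta.
  have jS : (j.+1 <= n - k)%N by rewrite -(subnSK kn) ltnS.
  by rewrite ?lift0 ?lift_max (maxn_idPr jS) (maxn_idPr (ltnW jS)).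
Qed.

End StepSums.

Section ExplicitPolynomials.
Context {R : realType}.
Variable n : nat.
Implicit Types (x y z : 'rV[R]_n.+1) (l : part n.+1) (beta : 'I_n -> R).

Lemma schurE l x : schur l x = tableau_sum (vars x) l.
Proof.
apply: (alternant_eq (P := fun x => tableau_sum (vars x) l));
  first exact: tableau_sum_continuous.
by move=> z gz; apply: alternant_ratio_schur => //; exact: (valP l).
Qed.

Definition beta_nat beta (r : nat) : R := oapp beta 0 (insub r).

Lemma beta_natE beta (r : 'I_n) : beta_nat beta r = beta r.
Proof. by rewrite /beta_nat valK. Qed.

Lemma beta_nat_le0 beta r : (forall i, beta i <= 0) -> beta_nat beta r <= 0.
Proof. by move=> b0; rewrite /beta_nat; case: insub => /=. Qed.

Lemma grothE beta l x : groth beta l x = up_sum (beta_nat beta) (vars x) n l.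
Proof.
apply: (alternant_eq (P := fun x => up_sum (beta_nat beta) (vars x) n l)).
  exact: up_sum_continuous.
move=> z gz; rewrite -(alternant_ratio_up_sum _ gz (valP l)) //.
apply: eq_alternant_ratio => j i; congr (_ * _).
have jn : (j <= n)%N by rewrite -ltnS.
rewrite (minn_idPl jn) (big_ord_widen n (fun r => 1 - beta_nat beta r * z ord0 i)) //.
by apply: eq_bigr => r _; rewrite beta_natE.
Qed.

Lemma groth_dualE beta l x :
  groth_dual beta l x = down_sum (beta_nat beta) (vars x) n l.
Proof.
apply: (alternant_eq (P := fun x => down_sum (beta_nat beta) (vars x) n l)).
  exact: down_sum_continuous.
move=> z gz; rewrite -(alternant_ratio_down_sum _ gz (valP l)) //.
apply: eq_alternant_ratio => j i; congr (_ * _).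
rewrite subnn maxn0 (big_nat_widenl _ 0) // big_mkord.
by apply: eq_bigr => r _; rewrite beta_natE.
Qed.

(** The dual Pieri rule. When every column carries the factor 1 - b t, it can also be pulled out of
    the rows; comparing with the column expansion gives the identity at generic points, and
    continuity extends it. *)
Lemma vertical_strip_sum (b : R) (l : {ffun 'I_n.+1 -> nat}) x : is_part l ->
  \sum_(e : {ffun 'I_n.+1 -> bool} | is_part (add_strip l e))
    (- b) ^+ countb e * tableau_sum (vars x) (add_strip l e) =
  (\prod_(i < n.+1) (1 - vars x i * b)) * tableau_sum (vars x) l.
Proof.
move=> lP; pose P (x : 'rV[R]_n.+1) := \sum_(e : {ffun 'I_n.+1 -> bool} | is_part
  (add_strip l e))
    (- b) ^+ countb e * tableau_sum (vars x) (add_strip l e).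
pose Q (x : 'rV[R]_n.+1) := (\prod_(i < n.+1) (1 - vars x i * b)) * tableau_sum (vars
  x) l.
apply: (@generic_continuous_eq _ _ P Q).
- apply: continuous_sum => e; apply: continuous_mul; first exact: cst_continuous.
  exact: tableau_sum_continuous.
- apply: continuous_mul; last exact: tableau_sum_continuous.
  apply: continuous_prod => i z;
    apply: (@continuousB R R _ (fun=> 1) (fun z => vars z i * b) z);
    first exact: cst_continuous.
  by apply: continuous_mul; [exact: vars_continuous|exact: cst_continuous].
move=> z gz; rewrite /P /Q.
rewrite -alternant_ratio_schur //.
have := @alternant_ratio_up _ _ (fun _ _ => 1) xpredT b z l lP (fun _ _ _ => erefl).
rewrite [X in X = _ -> _](_ : _ = (\prod_(i < n.+1) (1 - vars z i * b)) *
   alternant_ratio (fun j t => t ^+ (l j + (n - j))) z).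
  move=> ->; apply: eq_big => [e|e eP].
    by rewrite [X in X && _](_ : _ = true) //; apply/forallP => j; rewrite implybT.
  congr (_ * _); rewrite -alternant_ratio_schur //.
  by apply: eq_alternant_ratio => j i; rewrite mulr1.
rewrite /alternant_ratio mulrA; congr (_ / _).
have := det_scale_rows_cols (fun i : 'I_n.+1 => 1 - vars z i * b) (fun=> 1)
  (fun i j => z ord0 i ^+ (l j + (n - j))).
rewrite [X in _ * X * _]big1 // mulr1 => <-; congr (\det _).
by apply/matrixP => i j; rewrite !mxE /vars inord_val; lra.
Qed.

End ExplicitPolynomials.

(** * Vertical strips and triangular arrays *)

Section Kernels.
Context {R : realType}.
Variable n : nat.
Implicit Types (l mu nu : part n.+1) (S : pred 'I_n.+1) (e : {ffun 'I_n.+1 -> bool}).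

Definition strip S mu nu : bool :=
  [forall j, (mu j == nu j) || (S j && (mu j == (nu j).+1))].

Definition strip_weight S (b : R) mu nu : R :=
  if strip S mu nu then b ^+ (psize mu - psize nu) else 0.

Lemma stripP S mu nu :
  reflect (forall j : 'I_n.+1, mu j = nu j \/ (S j /\ mu j = (nu j).+1)) (strip S mu
    nu).
Proof.
apply: (iffP forallP) => h j.
  by case/orP: (h j) => [/eqP|/andP[? /eqP]]; [left|right].
by apply/orP; case: (h j) => [->|[-> ->]]; [left|right; rewrite eqxx].
Qed.

Lemma strip_weight_ge0 S b mu nu : 0 <= b -> 0 <= strip_weight S b mu nu.
Proof. by move=> b0; rewrite /strip_weight; case: ifP => // _; rewrite exprn_ge0. Qed.

Lemma skew_schur_trE mu nu b : skew_schur_tr mu nu b = strip_weight xpredT b mu nu.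
Proof. by []. Qed.

(** A strip is determined by its fixed end and the set of columns it meets, which reduces a sum over
    all partitions to a finite one. *)
Lemma esum_part_reindex (P : pred (part n.+1)) (Q : pred {ffun 'I_n.+1 -> bool})
    (g : {ffun 'I_n.+1 -> bool} -> {ffun 'I_n.+1 -> nat}) (H : part n.+1 -> R)
    (G : {ffun 'I_n.+1 -> bool} -> R) :
  (forall e, Q e -> is_part (g e)) ->
  (forall e e', Q e -> Q e' -> g e = g e' -> e = e') ->
  (forall e mu, Q e -> parts mu = g e -> P mu) ->
  (forall mu, P mu -> exists2 e, Q e & g e = parts mu) ->
  (forall e mu, Q e -> parts mu = g e -> H mu = G e) ->
  (forall e, 0 <= G e) ->
  \esum_(mu in [set: part n.+1]) (if P mu then H mu else 0)%:E =
  (\sum_(e | Q e) G e)%:E.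
Proof.
move=> gP gi gPmu gs gH G0; rewrite -esum_finType //.
transitivity (\esum_(mu in [set mu | P mu]) (H mu)%:E).
  rewrite [RHS]esum_mkcond; apply: eq_esum => mu _.
  rewrite (_ : (mu \in _) = P mu); first by case: (P mu).
  by apply/idP/idP; rewrite inE.
have p0 : part n.+1.
  have z : is_part ([ffun=> 0%N] : {ffun 'I_n.+1 -> nat}).
    by apply/is_partP => j; rewrite !ffunE.
  exact: (Part z).
have gK e : Q e -> parts (insubd p0 (g e)) = g e.
  by move=> Qe; rewrite -[LHS]/(val _) insubdK //; exact: gP.
rewrite (reindex_esum [set e | Q e] _ (fun e => insubd p0 (g e))).
  by apply: eq_esum => e /= Qe; rewrite (gH e) ?gK.
split=> [e /= Qe|e e' /set_mem /= Qe /set_mem /= Qe' /(congr1 (@parts _))|mu /= Pmu].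
- by apply: (gPmu e) => //; exact: gK.
- by rewrite !gK //; exact: gi.
- have [e Qe ge] := gs mu Pmu; exists e => //=.
  by apply: val_inj; rewrite /= gK.
Qed.

Lemma weight_add_strip (v : {ffun 'I_n.+1 -> nat}) e :
  weight (add_strip v e) = (weight v + countb e)%N.
Proof. by rewrite /weight -big_split; apply: eq_bigr => j _; rewrite add_stripE. Qed.

Lemma esum_strip_up S (b : R) l (F : {ffun 'I_n.+1 -> nat} -> R) :
  0 <= b -> (forall v, 0 <= F v) ->
  \esum_(mu in [set: part n.+1]) (F mu * strip_weight S b mu l)%:E =
  (\sum_(e : {ffun 'I_n.+1 -> bool} | [forall j, e j ==> S j] && is_part (add_strip l
    e))
     b ^+ countb e * F (add_strip l e))%:E.
Proof.
move=> b0 F0.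
transitivity (\esum_(mu in [set: part n.+1])
  (if strip S mu l then F mu * b ^+ (psize mu - psize l) else 0)%:E).
  by apply: eq_esum => mu _; rewrite /strip_weight; case: ifP => _; rewrite ?mulr0.
apply: (esum_part_reindex (g := add_strip l)) =>
  [e /andP[]//|e e' _ _ ee'|e mu /andP[/forallP eS _] mE|mu /stripP mS|e mu _ mE|e].
- apply/ffunP => j; have := congr1 (fun v : {ffun _ -> nat} => v j) ee'.
  by rewrite !add_stripE => /addnI; case: (e j); case: (e' j).
- apply/stripP => j; rewrite mE add_stripE; have := eS j.
  by case: (e j) => /= Sj; [right; rewrite addn1|left; rewrite addn0].
- have eE : add_strip l [ffun j => mu j != l j] = mu.
    apply: eq_natffun => j; rewrite add_stripE ffunE.
    by case: (mS j) => [->|[_ ->]]; rewrite ?eqxx ?addn0 // gtn_eqF ?addn1.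
  exists [ffun j => mu j != l j]; last exact: eE.
  rewrite eE (valP mu) andbT; apply/forallP => j; rewrite ffunE.
  by case: (mS j) => [->|[-> _]]; rewrite ?eqxx // implybT.
- rewrite /psize -/(weight mu) -/(weight l) mE weight_add_strip addKn mulrC.
  by [].
- by rewrite mulr_ge0 ?exprn_ge0.
Qed.

Lemma esum_strip_down S (b : R) l (F : {ffun 'I_n.+1 -> nat} -> R) :
  0 <= b -> (forall v, 0 <= F v) ->
  \esum_(mu in [set: part n.+1]) (strip_weight S b l mu * F mu)%:E =
  (\sum_(e : {ffun 'I_n.+1 -> bool} | [forall j, e j ==> S j] && down_ok l e)
     b ^+ countb e * F (sub_strip l e))%:E.
Proof.
move=> b0 F0.
transitivity (\esum_(mu in [set: part n.+1])
  (if strip S l mu then b ^+ (psize l - psize mu) * F mu else 0)%:E).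
  by apply: eq_esum => mu _; rewrite /strip_weight; case: ifP => _; rewrite ?mul0r.
have subK e : down_ok l e -> add_strip (sub_strip l e) e = l.
  move=> /andP[/forallP el _]; apply: eq_natffun => j.
  by rewrite add_stripE sub_stripE subnK.
apply: (esum_part_reindex (g := sub_strip l)) =>
  [e /andP[_ /andP[]]//|e e' /andP[_ eo] /andP[_ eo'] ee'|e mu /andP[/forallP eS eo]
  mE|mu /stripP mS|e mu /andP[_ eo] mE|e].
- apply/ffunP => j; have := congr1 (fun v : {ffun _ -> nat} => v j) ee'.
  have /andP[/forallP el _] := eo; have /andP[/forallP el' _] := eo'.
  have := el j; have := el' j.
  by rewrite !sub_stripE; case: (e j); case: (e' j) => //=; lia.
- apply/stripP => j; rewrite mE sub_stripE; have := eS j.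
  have /andP[/forallP el _] := eo; have := el j.
  by case: (e j) => /= lj Sj; [right; rewrite subn1 prednK|left; rewrite subn0].
- have eE : sub_strip l [ffun j => l j != mu j] = mu.
    apply: eq_natffun => j; rewrite sub_stripE ffunE.
    by case: (mS j) => [->|[_ ->]]; rewrite ?eqxx ?subn0 // gtn_eqF ?subn1.
  exists [ffun j => l j != mu j]; last exact: eE.
  rewrite /down_ok eE (valP mu) andbT; apply/andP; split; apply/forallP => j;
    rewrite ffunE.
    by case: (mS j) => [->|[-> _]]; rewrite ?eqxx // implybT.
  by case: (mS j) => [->|[_ ->]]; rewrite ?eqxx // gtn_eqF.
- rewrite /psize -/(weight mu) -/(weight l) mE -{1}(subK e eo) weight_add_strip addKn.
  by [].
- by rewrite mulr_ge0 ?exprn_ge0.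
Qed.

End Kernels.

(** * Splitting an array along its diagonal *)

Section Triangles.
Context {R : realType}.
Variable n : nat.
Implicit Types (l : part n.+1) (mu al de : {ffun 'I_n.+1 -> part n.+1}).

Lemma widen_ordE (r : 'I_n) : widen_ord (leqnSn n) r = lift ord_max r.
Proof. by apply: ord_inj; rewrite lift_max. Qed.

Definition strips (S : nat -> pred 'I_n.+1) mu : bool :=
  [forall r : 'I_n, strip (S r) (mu (lift ord_max r)) (mu (lift ord0 r))].

(** The step from row r to row r+1 is assigned by column: a step arriving at the diagonal, j = r+1,
    belongs to the upper array, and one leaving it, j = r, to the lower array. *)
Definition above (r : nat) : pred 'I_n.+1 := fun j => (r < j)%N.
Definition below (r : nat) : pred 'I_n.+1 := fun j => (j <= r)%N.

Definition join_rows l al de (r : 'I_n.+1) : {ffun 'I_n.+1 -> nat} :=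
  [ffun j : 'I_n.+1 => if (j <= r)%N then de r j else al r j].
Definition upper_row l mu (r : 'I_n.+1) : {ffun 'I_n.+1 -> nat} :=
  [ffun j : 'I_n.+1 => if (j <= r)%N then l j else mu r j].
Definition lower_row l mu (r : 'I_n.+1) : {ffun 'I_n.+1 -> nat} :=
  [ffun j : 'I_n.+1 => if (j < r)%N then mu r j else l j].

Definition join_array l (p : {ffun 'I_n.+1 -> part n.+1} * {ffun 'I_n.+1 -> part
  n.+1}) :
    {ffun 'I_n.+1 -> part n.+1} :=
  [ffun r => insubd l (join_rows l p.1 p.2 r)].

Lemma insubdE l (v : {ffun 'I_n.+1 -> nat}) (j : 'I_n.+1) :
  is_part v -> insubd l v j = v j.
Proof. by move=> vP; rewrite -[insubd l v j]/(val (insubd l v) j) insubdK. Qed.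

Lemma part_le l (j : 'I_n) : (l (lift ord0 j) <= l (lift ord_max j))%N.
Proof. exact: (is_partP _ (valP l)). Qed.

(** Column j changes only in steps r < j, so from row j on it has its final value. *)
Lemma strips_up_const l al : strips above al -> al ord_max = l ->
  forall i j : 'I_n.+1, (j <= i)%N -> al i j = l j.
Proof.
move=> /forallP alS almax i; move: {2}(n - i)%N (erefl (n - i)%N) => k.
elim: k i => [|k IH] i ik j ji.
  by rewrite (_ : i = ord_max) ?almax //; apply: ord_inj => /=; have := ltn_ord i; lia.
case: (ord_caseS_max i) ik ji => [[r ->]|->]; last by rewrite almax.
rewrite lift_max => rk jr; rewrite -(IH (lift ord0 r)) ?lift0 ?(leqW jr) //;
  last by lia.
by have /stripP/(_ j)[//|[]] := alS r; rewrite /above ltnNge jr.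
Qed.

Lemma strips_down_const l de : strips below de -> de ord0 = l ->
  forall i j : 'I_n.+1, (i <= j)%N -> de i j = l j.
Proof.
move=> /forallP deS de0 i; move: {2}(nat_of_ord i) (erefl (nat_of_ord i)) => k.
elim: k i => [|k IH] i ik j ij.
  by rewrite (_ : i = ord0) ?de0 //; apply: ord_inj.
case: (ord_caseS0 i) ik ij => [[r ->]|->]; last by rewrite de0.
rewrite lift0 => -[rk] rj; rewrite -(IH (lift ord_max r)) ?lift_max ?(ltnW rj) //.
by have /stripP/(_ j)[//|[]] := deS r; rewrite /below leqNgt rj.
Qed.

Lemma join_rowsE l al de (i j : 'I_n.+1) :
  strips above al -> al ord_max = l -> strips below de -> de ord0 = l ->
  (join_rows l al de i j + l j = al i j + de i j)%N.
Proof.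
move=> aS a1 dS d0; rewrite ffunE; case: leqP => ij.
  by rewrite (strips_up_const aS a1 ij) addnC.
by rewrite (strips_down_const dS d0 (ltnW ij)).
Qed.

(** Both pieces of row i equal l_i at the diagonal, so each inequality between neighbours lies
    within one piece. This is the independence of the two triangles. *)
Lemma join_rows_part l al de (i : 'I_n.+1) :
  strips above al -> al ord_max = l -> strips below de -> de ord0 = l ->
  is_part (join_rows l al de i).
Proof.
move=> aS a1 dS d0; apply/is_partP => j; rewrite !ffunE lift0 lift_max.
have := part_le (al i) j; have := part_le (de i) j.
have := strips_up_const aS a1 (i := i) (j := lift ord_max j).
have := strips_down_const dS d0 (i := i) (j := lift ord_max j).
rewrite lift_max; case: (ltngtP j i) => [ji|ij|ji] // h1 h2.
by rewrite h1 // h2.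
Qed.

Lemma upper_row_part l mu (i : 'I_n.+1) : (forall r, mu r r = l r) ->
  is_part (upper_row l mu i).
Proof.
move=> mul; apply/is_partP => j; rewrite !ffunE lift0 lift_max.
have := part_le l j; have := part_le (mu i) j.
case: (ltngtP j i) => // ji h _; move: h;
  rewrite -(mul (lift ord_max j)) (_ : lift ord_max j = i) //.
by apply: ord_inj; rewrite lift_max.
Qed.

Lemma lower_row_part l mu (i : 'I_n.+1) : (forall r, mu r r = l r) ->
  is_part (lower_row l mu i).
Proof.
move=> mul; apply/is_partP => j; rewrite !ffunE lift0 lift_max.
have := part_le l j; have := part_le (mu i) j.
case: (ltngtP j.+1 i) => // ji h _; move: h.
by rewrite -(mul (lift ord0 j)) (_ : lift ord0 j = i) //; apply: ord_inj; rewrite lift0.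
Qed.

Definition diagonal_arrays l : set {ffun 'I_n.+1 -> part n.+1} :=
  [set mu | strips (fun=> xpredT) mu && [forall i, mu i i == l i]].
Definition upper_arrays l : set {ffun 'I_n.+1 -> part n.+1} :=
  [set al | strips above al && (al ord_max == l)].
Definition lower_arrays l : set {ffun 'I_n.+1 -> part n.+1} :=
  [set de | strips below de && (de ord0 == l)].

Lemma join_array_bij l :
  set_bij (upper_arrays l `*` lower_arrays l) (diagonal_arrays l) (join_array l).
Proof.
have joinE al de i j : (upper_arrays l `*` lower_arrays l) (al, de) ->
    join_array l (al, de) i j = join_rows l al de i j.
  move=> [/= /andP[aS /eqP a1] /andP[dS /eqP d0]].
  by rewrite [join_array _ _ _]ffunE insubdE //; exact: join_rows_part.
split.
- move=> [al de] ad; have [/= /andP[aS /eqP a1] /andP[dS /eqP d0]] := ad.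
  apply/andP; split; last first.
    apply/forallP => i; rewrite joinE // ffunE leqnn.
    by rewrite (strips_down_const dS d0).
  apply/forallP => r; apply/stripP => j; rewrite !joinE //.
  have := join_rowsE (lift ord_max r) j aS a1 dS d0.
  have := join_rowsE (lift ord0 r) j aS a1 dS d0.
  have /stripP/(_ j) := forallP aS r; have /stripP/(_ j) := forallP dS r.
  rewrite /above /below; case: leqP => rj.
    by case=> [->|[_ ->]] [->|[]] // => h1 h2; [left|right; split=> //]; lia.
  by case=> [->|[]] // [->|[_ ->]] h1 h2; [left|right; split=> //]; lia.
- move=> [al de] [al' de'] /set_mem ad /set_mem ad' e.
  have [/= /andP[aS /eqP a1] /andP[dS /eqP d0]] := ad.
  have [/= /andP[aS' /eqP a1'] /andP[dS' /eqP d0']] := ad'.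
  have ee (i j : 'I_n.+1) : join_rows l al de i j = join_rows l al' de' i j.
    by rewrite -!joinE // e.
  congr pair; apply/ffunP => i; apply: val_inj; apply: eq_natffun => j;
    have := ee i j; rewrite !ffunE.
    by case: leqP => // ij _; rewrite (strips_up_const aS a1) // (strips_up_const aS'
      a1').
  case: leqP => // ij _.
  by rewrite (strips_down_const dS d0) ?(strips_down_const dS' d0') // ltnW.
- move=> mu /= /andP[muS /forallP mud]; have mul r : mu r r = l r by apply/eqP.
  have up i := upper_row_part i mul; have lp i := lower_row_part i mul.
  pose al := [ffun r : 'I_n.+1 =>
    insubd l (upper_row l mu r)] : {ffun 'I_n.+1 -> part n.+1}.
  pose de := [ffun r : 'I_n.+1 =>
    insubd l (lower_row l mu r)] : {ffun 'I_n.+1 -> part n.+1}.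
  have alE (i j : 'I_n.+1) : al i j = if (j <= i)%N then l j else mu i j.
    by rewrite [al i]ffunE insubdE // ffunE.
  have deE (i j : 'I_n.+1) : de i j = if (j < i)%N then mu i j else l j.
    by rewrite [de i]ffunE insubdE // ffunE.
  have ad : (upper_arrays l `*` lower_arrays l) (al, de).
    split=> /=; apply/andP; split.
    + apply/forallP => r; apply/stripP => j; rewrite !alE lift_max lift0 /above.
      have /stripP/(_ j) := forallP muS r.
      case: (leqP j r) => jr; first by rewrite leqW //; left.
      case: leqP => jr'; last by case=> [->|[]]; [left|right].
      have -> : j = lift ord0 r by apply: ord_inj; rewrite lift0; apply/eqP;
        rewrite eqn_leq jr' jr.
      by rewrite mul; case=> [->|[]]; [left|right].
    + apply/eqP/val_inj/eq_natffun => j /=; rewrite alE.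
      by rewrite -ltnS ltn_ord.
    + apply/forallP => r; apply/stripP => j; rewrite !deE lift_max lift0 /below ltnS.
      have /stripP/(_ j) := forallP muS r.
      case: (ltngtP j r) => jr; try by left.
        by case=> [->|[]]; [left|right].
      have -> : j = lift ord_max r by apply: ord_inj; rewrite lift_max.
      by rewrite mul; case=> [->|[]]; [left|right].
    + by apply/eqP/val_inj/eq_natffun => j /=; rewrite deE.
  exists (al, de) => //; apply/ffunP => i; apply/val_inj/eq_natffun => j.
  rewrite -[LHS]/(join_array l (al, de) i j) joinE // ffunE alE deE.
  case: ltngtP => // ij; rewrite (_ : j = i) ?mul //; exact: ord_inj.
Qed.

End Triangles.

(** * Weight of a fiber and total mass *)

Section Fibers.
Context {R : realType}.
Variables (n : nat) (b : nat -> R) (x y : nat -> R).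
Hypotheses (b_le0 : forall r, b r <= 0) (x_ge0 : forall i, 0 <= x i)
  (y_ge0 : forall i, 0 <= y i).
Implicit Types (l : part n.+1) (mu al de : {ffun 'I_n.+1 -> part n.+1}).

Let oppb_ge0 r : 0 <= - b r. Proof. by rewrite oppr_ge0. Qed.

Definition row_kernel (S : nat -> pred 'I_n.+1) (r : nat) : part n.+1 -> part n.+1 ->
  R :=
  strip_weight (S r) (- b r).

Lemma row_kernel_ge0 S r t t' : 0 <= row_kernel S r t t'.
Proof. exact: strip_weight_ge0. Qed.

Definition array_weight mu : R :=
  path_weight (fun t : part n.+1 => tableau_sum x t) (row_kernel (fun=> xpredT)) mu
  * tableau_sum y (mu ord_max).

Lemma path_weight_strips (f : part n.+1 -> R) S mu : ~~ strips S mu ->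
  path_weight f (row_kernel S) mu = 0.
Proof.
rewrite /strips negb_forall => /existsP[r rN].
by rewrite /path_weight (bigD1 r) //= widen_ordE /row_kernel /strip_weight (negbTE
  rN) mul0r mulr0.
Qed.

Lemma array_weight_ge0 mu : 0 <= array_weight mu.
Proof.
rewrite mulr_ge0 ?tableau_sum_ge0 //; apply: path_weight_ge0 => *.
  exact: tableau_sum_ge0.
exact: row_kernel_ge0.
Qed.

(** The joined array starts with row 0 of al and ends with the last row of de, since the other
    triangle is frozen there; in between, the strip sizes add. *)
Lemma array_weight_join l al de : upper_arrays l al -> lower_arrays l de ->
  array_weight (join_array l (al, de)) =
  path_weight (fun t : part n.+1 => tableau_sum x t) (row_kernel (@above n)) al *
  (path_weight (fun=> 1) (row_kernel (@below n)) de * tableau_sum y (de ord_max)).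
Proof.
move=> alU deL; have /= /andP[aS /eqP a1] := alU; have /= /andP[dS /eqP d0] := deL.
have /= /andP[jS _] : diagonal_arrays l (join_array l (al, de)).
  by apply: (set_bij_homo (join_array_bij l)).
have jE (i j : 'I_n.+1) : (join_array l (al, de) i j + l j = al i j + de i j)%N.
  rewrite -(join_rowsE i j aS a1 dS d0); congr addn.
  by rewrite [join_array _ _ _]ffunE insubdE //; exact: join_rows_part.
have j0 : join_array l (al, de) ord0 = al ord0.
  by apply/val_inj/eq_natffun => j; have := jE ord0 j; rewrite d0 => /addIn.
have jm : join_array l (al, de) ord_max = de ord_max.
  apply/val_inj/eq_natffun => j; have := jE ord_max j; rewrite a1 addnC => /addnI.
  by [].
rewrite /array_weight /path_weight j0 jm mul1r -!mulrA; congr (_ * _).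
rewrite mulrA; congr (_ * _); rewrite -big_split; apply: eq_bigr => r _ /=.
rewrite !widen_ordE /row_kernel /strip_weight.
have /forallP/(_ r) jr := jS; have /forallP/(_ r) ar := aS;
  have /forallP/(_ r) dr := dS.
rewrite jr ar dr -exprD; congr (_ ^+ _).
have le (S : pred 'I_n.+1) (t t' : part n.+1) : strip S t t' -> (psize t' <= psize t)%N.
  by move=> /stripP h; apply: leq_sum => j _; case: (h j) => [->|[_ ->]].
have sE i : (psize (join_array l (al, de) i) + psize l = psize (al i) + psize (de i))%N.
  by rewrite /psize -!big_split; apply: eq_bigr => j _; exact: jE.
have := (sE (lift ord_max r)); have := sE (lift ord0 r).
by have := le _ _ _ jr; have := le _ _ _ ar; have := le _ _ _ dr; lia.
Qed.

Lemma esum_strips (S : nat -> pred 'I_n.+1) (P : pred {ffun 'I_n.+1 -> part n.+1})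
    (f : part n.+1 -> R) (F : {ffun 'I_n.+1 -> part n.+1} -> R) :
  \esum_(mu in [set mu | strips S mu && P mu])
     (path_weight f (row_kernel S) mu * F mu)%:E =
  \esum_(mu in [set mu | P mu]) (path_weight f (row_kernel S) mu * F mu)%:E.
Proof.
rewrite esum_mkcond [RHS]esum_mkcond; apply: eq_esum => mu _.
rewrite (_ : (mu \in [set mu | P mu]) = P mu); last by apply/idP/idP; rewrite inE.
rewrite (_ : (mu \in _) = strips S mu && P mu); last by apply/idP/idP; rewrite inE.
case: (P mu); rewrite ?andbF // andbT; case: ifPn => // mN.
by rewrite path_weight_strips ?mul0r.
Qed.

(** The last row is fixed, so the sum runs forward with a delta at l as test function; the one-step
    sum is the recursion of [up_sum]. *)
Lemma esum_upper l :
  \esum_(al in upper_arrays l)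
    (path_weight (fun t : part n.+1 => tableau_sum x t) (row_kernel (@above n)) al)%:E =
  (up_sum b x n l)%:E.
Proof.
transitivity (\esum_(al in [set: {ffun 'I_n.+1 -> part n.+1}])
  (path_weight (fun t : part n.+1 => tableau_sum x t) (row_kernel (@above n)) al *
     (al ord_max == l)%:R)%:E).
  rewrite [LHS]esum_mkcond; apply: eq_esum => al _.
  rewrite (_ : (al \in _) = strips (@above n) al && (al ord_max == l));
    last by apply/idP/idP; rewrite inE.
  case: eqP => _; rewrite ?andbF ?mulr0 // andbT mulr1; case: ifPn => // aN.
  by rewrite path_weight_strips.
rewrite (@esum_path_forward _ _ _ _ _ _ (fun k (t : part n.+1) =>
  up_sum b x k t) n (fun t : part n.+1 => (t == l)%:R)) //.
- transitivity (\esum_(t in [set: part n.+1]) ((t == l)%:R * up_sum b x n t)%:E).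
    by apply: eq_esum => t _; rewrite mulrC.
  by rewrite esum_delta // => t; exact: up_sum_ge0.
- by move=> t; exact: tableau_sum_ge0.
- by move=> *; exact: row_kernel_ge0.
- by move=> *; exact: up_sum_ge0.
- move=> k t _; rewrite (esum_strip_up (@above n k) t) //.
  by move=> v; exact: up_sum_ge0.
Qed.

(** The first row is fixed, so the delta at l is the initial weight and the sum runs backward. *)
Lemma esum_lower l :
  \esum_(de in lower_arrays l)
    (path_weight (fun=> 1) (row_kernel (@below n)) de * tableau_sum y (de ord_max))%:E =
  (down_sum b y n l)%:E.
Proof.
transitivity (\esum_(de in [set: {ffun 'I_n.+1 -> part n.+1}])
  (path_weight (fun t : part n.+1 => (t == l)%:R) (row_kernel (@below n)) de *
     down_sum b y (n - n) (de ord_max))%:E).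
  rewrite [LHS]esum_mkcond; apply: eq_esum => de _.
  rewrite (_ : (de \in _) = strips (@below n) de && (de ord0 == l));
    last by apply/idP/idP; rewrite inE.
  rewrite subnn; case: ifPn => [/andP[_ d0]|]; first by rewrite /path_weight d0.
  rewrite negb_and => /orP[dN|/negbTE d0]; first by rewrite path_weight_strips ?mul0r.
  by rewrite /path_weight d0 !mul0r.
rewrite (@esum_path_backward _ _ _ _ _ _ (fun k (t : part n.+1) =>
  down_sum b y (n - k) t) n) //.
- by rewrite esum_delta ?subn0 // => t; exact: down_sum_ge0.
- by move=> *; exact: row_kernel_ge0.
- by move=> *; exact: down_sum_ge0.
- move=> k t kn; rewrite (esum_strip_down (@below n k) t) //; last by move=> v;
  exact: down_sum_ge0.
  (* As k < n, n - k is a successor and [down_sum] unfolds, with parameter index n - (n - k) = k. *)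
  rewrite -[in RHS](subnSK kn) /= (subnSK kn).
  by rewrite (_ : n - (n - k) = k)%N // subKn // ltnW.
Qed.

Lemma esum_diagonal l :
  \esum_(mu in diagonal_arrays l) (array_weight mu)%:E =
  (up_sum b x n l * down_sum b y n l)%:E.
Proof.
rewrite (reindex_esum _ _ _ _ (join_array_bij l)).
have f0 al : 0 <= path_weight (fun t : part n.+1 =>
  tableau_sum x t) (row_kernel (@above n)) al.
  by apply: path_weight_ge0 => *; [exact: tableau_sum_ge0|exact: row_kernel_ge0].
have g0 de : 0 <= path_weight (fun=> 1) (row_kernel (@below n)) de * tableau_sum y
  (de ord_max).
  rewrite mulr_ge0 ?tableau_sum_ge0 //.
  by apply: path_weight_ge0 => *; [|exact: row_kernel_ge0].
rewrite -(esum_prod f0 g0 (esum_upper l) (esum_lower l)).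
by apply: eq_esum => -[al de] [alU deL]; rewrite array_weight_join.
Qed.

Lemma esum_diagonal_set (A : set {ffun 'I_n.+1 -> nat}) :
  \esum_(mu in (fun mu : {ffun 'I_n.+1 -> part n.+1} => [ffun i : 'I_n.+1 =>
    mu i i]) @^-1` A)
    (array_weight mu)%:E =
  \esum_(l in (fun l : part n.+1 => parts l) @^-1` A)
    (up_sum b x n l * down_sum b y n l)%:E.
Proof.
under [RHS]eq_esum do rewrite -esum_diagonal.
rewrite esum_esum; last by move=> l mu _ _; rewrite lee_fin array_weight_ge0.
pose D mu : {ffun 'I_n.+1 -> nat} := [ffun i => mu i i].
have DE mu l : [forall i, mu i i == l i] -> D mu = l.
  by move=> /forallP h; apply: eq_natffun => i; rewrite ffunE; exact/eqP.
transitivity (\esum_(mu in [set mu | strips (fun=> xpredT) mu && `[< A (D mu) >]])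
  (array_weight mu)%:E).
  rewrite esum_strips; congr esum; apply/seteqP; split=> mu /=; first by move=> ?;
    exact/asboolP.
  by move/asboolP.
rewrite (@reindex_esum _ _ _ ((fun l : part n.+1 =>
  parts l) @^-1` A `*`` @diagonal_arrays n) _ snd) //.
split.
- move=> [l mu] [/= Al /andP[-> /= /DE Dl]]; apply/asboolP.
  by rewrite Dl.
- move=> [l mu] [l' mu'] /set_mem[/= _ /andP[_ /DE lE]] /set_mem[/= _ /andP[_ /DE
  lE']] mm.
  by rewrite mm in lE *; congr pair; apply: val_inj; rewrite /= -lE -lE'.
- move=> mu /= /andP[muS /asboolP Amu].
  (* Rows decrease along the array: mu^(j+1)_(j+1) <= mu^j_(j+1) <= mu^j_j. So arrays of nonzero
     weight lie over partitions. *)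
  have DP : is_part (D mu).
    apply/is_partP => j; rewrite !ffunE.
    apply: leq_trans (part_le (mu (lift ord_max j)) j).
    by have /stripP/(_ (lift ord0 j)) := forallP muS j; case=> [->|[_ ->]].
  exists (Part DP, mu) => //; split=> //; apply/andP; split=> //.
  by apply/forallP => i; rewrite /= ffunE.
Qed.

(** By the dual Pieri rule each row summed out multiplies [tableau_sum x] by a constant, and the
    Cauchy identity sums the last row. The rule enters as a hypothesis because x is any sequence
    here, while [vertical_strip_sum] concerns coordinates of a vector. *)
Lemma esum_array_weight : (forall i j, (i <= n)%N -> (j <= n)%N -> x i * y j < 1) ->
  (forall (c : R) (l : {ffun 'I_n.+1 -> nat}), is_part l ->
    \sum_(e : {ffun 'I_n.+1 -> bool} | is_part (add_strip l e))
      (- c) ^+ countb e * tableau_sum x (add_strip l e) =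
    (\prod_(i < n.+1) (1 - x i * c)) * tableau_sum x l) ->
  \esum_(mu in [set: {ffun 'I_n.+1 -> part n.+1}]) (array_weight mu)%:E =
  ((\prod_(r < n) \prod_(i < n.+1) (1 - x i * b r)) *
   \prod_(i < n.+1) \prod_(j < n.+1) (1 - x i * y j)^-1)%:E.
Proof.
move=> xy1 vs; have xb i r : 0 <= 1 - x i * b r.
  by rewrite subr_ge0 (le_trans _ ler01) // mulr_ge0_le0.
rewrite (@esum_path_forward _ _ _ _ _ _
  (fun k (t : part n.+1) => (\prod_(r < k) \prod_(i < n.+1) (1 - x i * b r)) *
    tableau_sum x t) n
  (fun t : part n.+1 => tableau_sum y t)).
- transitivity ((\prod_(r < n) \prod_(i < n.+1) (1 - x i * b r))%:E *
    \esum_(l in [set: {ffun 'I_n.+1 -> nat}]) (schurc x n.+1 l * schurc y n.+1 l)%:E)%E.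
    rewrite -esumZl_ge0; last 2 first.
    + by rewrite prodr_ge0 // => r _; rewrite prodr_ge0.
    + by move=> l; rewrite lee_fin mulr_ge0 ?schurc_ge0.
    rewrite [RHS](_ : _ = \esum_(l in [set l : {ffun 'I_n.+1 -> nat} | is_part l])
       ((\prod_(r < n) \prod_(i < n.+1) (1 - x i * b r))%:E *
        (schurc x n.+1 l * schurc y n.+1 l)%:E)%E); last first.
      rewrite [RHS]esum_mkcond; apply: eq_esum => l _; case: ifPn => //.
      by rewrite notin_setE /= /schurc => /negP/negbTE ->; rewrite /= mul0r mule0.
    rewrite (@reindex_esum _ _ _ [set: part n.+1] _ (@parts n.+1)); last first.
      split=> [l _|l l' _ _ /val_inj//|l /= lP]; first exact: (valP l).
      by exists (Part lP).
    apply: eq_esum => l _; rewrite -EFinM !schurc_full ?(valP l) //.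
    by congr EFin; lra.
  rewrite schur_cauchy // => i j; rewrite !ltnS; exact: xy1.
- by move=> t; exact: tableau_sum_ge0.
- by move=> *; exact: row_kernel_ge0.
- by move=> k t; rewrite mulr_ge0 ?tableau_sum_ge0 // prodr_ge0 // => r _;
  rewrite prodr_ge0.
- by move=> t; exact: tableau_sum_ge0.
- by move=> t; rewrite big_ord0 mul1r.
- move=> k l kn.
  transitivity ((\prod_(r < k) \prod_(i < n.+1) (1 - x i * b r))%:E *
     \esum_(t in [set: part n.+1]) (tableau_sum x t * row_kernel (fun=> xpredT) k t
       l)%:E)%E.
    rewrite -esumZl_ge0; last 2 first.
    + by rewrite prodr_ge0 // => r _; rewrite prodr_ge0.
    + by move=> t; rewrite lee_fin mulr_ge0 ?tableau_sum_ge0 ?row_kernel_ge0.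
    by apply: eq_esum => t _; rewrite -EFinM mulrA.
  rewrite (esum_strip_up xpredT l (F := fun v => tableau_sum x v)) //; last first.
    by move=> v; exact: tableau_sum_ge0.
  rewrite -EFinM big_ord_recr -mulrA; congr (_ * _)%:E.
  rewrite -vs ?(valP l) //; apply: eq_bigl => e.
  by rewrite [X in X && _](_ : _ = true) //; apply/forallP => j; rewrite implybT.
Qed.

End Fibers.

Theorem proposition3p2 (R : realType) (n : nat) (x y : 'rV[R]_n.+1)
    (beta : 'I_n -> R)
    (x_ge0 : forall i, 0 <= x ord0 i)
    (y_ge0 : forall j, 0 <= y ord0 j)
    (beta_le0 : forall r, beta r <= 0)
    (xy_lt1 : forall i j, x ord0 i * y ord0 j < 1) :
  [/\ is_pmf (groth_measure x y beta),
      is_pmf (schur_process x y beta) &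
      forall A : set {ffun 'I_n.+1 -> nat},
        law_of (groth_measure x y beta) (fun l => parts l) A =
        law_of (schur_process x y beta)
               (fun mu => [ffun i : 'I_n.+1 => mu i i]) A].
Proof.
pose b := beta_nat beta; have b0 r : b r <= 0 by exact: beta_nat_le0.
have x0 i : 0 <= vars x i by exact: x_ge0.
have y0 i : 0 <= vars y i by exact: y_ge0.
have wE mu : schur_weight x y beta mu = array_weight b (vars x) (vars y) mu.
  rewrite /schur_weight /array_weight /path_weight !schurE; congr (_ * _ * _).
  by apply: eq_bigr => r _; rewrite skew_schur_trE /row_kernel /b beta_natE widen_ordE.
pose P := \prod_(i < n.+1) \prod_(j < n.+1) (1 - x ord0 i * y ord0 j).
pose Q := \prod_(i < n.+1) \prod_(r < n) (1 - x ord0 i * beta r).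
have P0 : 0 < P by rewrite prodr_gt0 // => i _; rewrite prodr_gt0 // => j _;
  rewrite subr_gt0.
have Q0 : 0 < Q.
  rewrite prodr_gt0 // => i _; rewrite prodr_gt0 // => j _.
  by rewrite subr_gt0 (le_lt_trans _ ltr01) // mulr_ge0_le0.
have gE l : groth_measure x y beta l =
    P / Q * (up_sum b (vars x) n l * down_sum b (vars y) n l).
  by rewrite /groth_measure grothE groth_dualE mulrA.
have Z : \esum_(mu in [set: {ffun 'I_n.+1 -> part n.+1}]) (schur_weight x y beta
  mu)%:E = (Q / P)%:E.
  under eq_esum do rewrite wE.
  rewrite esum_array_weight //.
  - congr EFin; congr (_ * _).
      rewrite exchange_big; apply: eq_bigr => i _; apply: eq_bigr => r _.
      by rewrite /vars inord_val /b beta_natE.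
    rewrite /P -prodfV; apply: eq_bigr => i _; rewrite -prodfV; apply: eq_bigr => j _.
    by rewrite /vars !inord_val.
  - by move=> i j _ _; exact: xy_lt1.
  - by move=> c l lP; exact: vertical_strip_sum.
have sE mu : schur_process x y beta mu = P / Q * array_weight b (vars x) (vars y) mu.
  by rewrite /schur_process Z /= wE invf_div mulrC.
have c0 : 0 <= P / Q by rewrite divr_ge0 // ltW.
have law (A : set {ffun 'I_n.+1 -> nat}) :
    law_of (groth_measure x y beta) (fun l => parts l) A =
    law_of (schur_process x y beta) (fun mu => [ffun i : 'I_n.+1 => mu i i]) A.
  rewrite /law_of; under eq_esum do rewrite gE EFinM.
  under [RHS]eq_esum do rewrite sE EFinM.
  rewrite !esumZl_ge0 //; first by rewrite esum_diagonal_set.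
    by move=> mu; rewrite lee_fin array_weight_ge0.
  by move=> l; rewrite lee_fin mulr_ge0 ?up_sum_ge0 ?down_sum_ge0.
have tot : \esum_(mu in [set: {ffun 'I_n.+1 -> part n.+1}]) (schur_process x y beta
  mu)%:E = 1%:E.
  under eq_esum do rewrite sE -wE EFinM.
  rewrite esumZl_ge0 //; last by move=> mu; rewrite lee_fin wE array_weight_ge0.
  by rewrite Z -EFinM mulf_div [Q * P]mulrC divff // mulf_neq0 // gt_eqF.
split=> //.
- split=> [l|].
    by rewrite gE mulr_ge0 // mulr_ge0 ?up_sum_ge0 ?down_sum_ge0.
  (* The Grothendieck measure inherits its total mass from the Schur process. *)
  by rewrite -tot; exact: (law setT).
- by split=> // mu; rewrite sE mulr_ge0 ?array_weight_ge0.
Qed.
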